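(* Let $w\in\widetilde{S_n}$ and let $(P,Q,\rho)$ be its image under AMBC, with $P,Q$ of shape $\lambda$. Then \[\operatorname{sgn}(w)\cdot(-1)^{\sum_{i=1}^n (w(i)-i)}=(-1)^{\operatorname{inv}(P)+\operatorname{inv}(Q)+\operatorname{inv}(\lambda)+\operatorname{inv}_\lambda(\rho)}.\]
   Context: Fix $n\ge1$. For $i\in\mathbb Z$ write $\overline{i}=i+n\mathbb Z$, $[\overline n]=\{\overline 1,\dots,\overline n\}$. $\widetilde{S_n}$ is the set of bijections $w:\mathbb Z\to\mathbb Z$ with $w(i+n)=w(i)+n$; more generally a partial permutation is an injection $w:U\to\mathbb Z$ with $U\subseteq\mathbb Z$ stable under $x\mapsto x\pm n$ and $w(i+n)=w(i)+n$. The balls of $w$ are the points $(i,w(i))$ (first coordinate = row, increasing southward; second = column, increasing eastward). A cell $(i,j)$ is northwest of $(i',j')$ if $i\le i'$, $j\le j'$ (strictly if both strict), northeast if $i\le i'$, $j\ge j'$, southwest if $i\ge i'$, $j\le j'$. Translates: images under $(i,j)\mapsto(i+kn,j+kn)$. AMBC. For a nonempty partial permutation $w$: a channel is a set of balls, invariant under translation by $(n,n)$, totally ordered by the northwest order, with maximal number of translation classes among such sets. There is a unique southwest-most channel $C$ (for every channel $C'$, each ball of $C$ is weakly southwest of some ball of $C'$). Number $C$ by consecutive integers $\tilde d$ increasing from northwest to southeast; for each ball $b$ set $d(b)=\max(\tilde d(b_k)+k)$ over sequences of balls $b=b_0,\dots,b_k$ with $b_{t+1}$ strictly northwest of $b_t$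 and $b_k\in C$ (finite). For each $t$, write the balls with $d=t$ as $(i_1,j_1),\dots,(i_s,j_s)$, $i_1<\dots<i_s$ (so $j_1>\dots>j_s$); outer corners are $(i_{r+1},j_r)$, $1\le r<s$; back corner is $(i_1,j_s)$. $\mathrm{fw}(w)$ is the partial permutation whose balls are all outer corners; $S$ is the set of back corners. Record the residues mod $n$ of the column indices of $S$ as the next row of $P$, of the row indices as the next row of $Q$, and $\sum_c(\lceil c_2/n\rceil-\lceil c_1/n\rceil)$ (one representative $c=(c_1,c_2)$ per translation class of $S$) as the next entry of $\rho$; then replace $w$ by $\mathrm{fw}(w)$ and repeat until empty. For $w\in\widetilde{S_n}$, $P,Q$ are tabloids of a common shape $\lambda$, a partition of $n$ ($\lambda_r$ = number of translation classes of back corners at step $r$), each containing every element of $[\overline n]$ once; a tabloid is a sequence of disjoint subsets (rows) of $[\overline n]$, row 1 highest. $\rho\in\mathbb Z^{\ell(\lambda)}$. Sign: the length $\ell(w)$ is the number of translation classes (under simultaneous translation by $(n,n)$) of pairs $(a,b)$ of balls of $w$ with $a$ strictly northeast of $b$; $\operatorname{sgn}(w)=(-1)^{\ell(w)}$. Broken order: the linear order $\overline1<\overline2<\dots<\overline n$ on $[\overline n]$. For a tabloid $T$, $\operatorname{inv}(T)$ is the number of pairs $\overline i<\overline j$ (broken order) such that $\overline i$ is in a strictly lower row of $T$ than $\overline j$. For a partition $\lambda$, $\operatorname{inv}(\lambda)=\lambda_2+\lambda_4+\lambda_6+\cdots$. For $\rho\in\mathbb Z^{\ell(\lambda)}$,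 $\operatorname{inv}_\lambda(\rho)=\sum_{i:\ \lambda_i \text{ odd}}\rho_i$. *)

(* Defs.v *)
From mathcomp Require Import all_boot all_order all_algebra.
Set Implicit Arguments. Unset Strict Implicit. Unset Printing Implicit Defensive.
Import Order.TTheory GRing.Theory Num.Theory.
Local Open Scope ring_scope.

(* A cell (row, column); rows increase southward, columns eastward. *)
Definition cell := (int * int)%type.
Definition cellset := cell -> Prop.

Definition ncard (T : eqType) (X : T -> Prop) (k : nat) : Prop :=
  exists s : seq T, [/\ uniq s, (forall x, x \in s <-> X x) & size s = k].

Definition trinv (n : nat) (X : cellset) : Prop :=
  forall x : cell, X x <-> X (x.1 + n%:Z, x.2 + n%:Z).

(* number of translation classes of a translation-invariant set of cells:
   each class has exactly one representative with row in [1, n]. *)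
Definition ncl (n : nat) (X : cellset) (k : nat) : Prop :=
  ncard (fun x : cell => X x /\ (1 <= x.1 <= n%:Z)) k.

Definition nw (a b : cell) : Prop := a.1 <= b.1 /\ a.2 <= b.2.
Definition snwb (a b : cell) : bool := (a.1 < b.1) && (a.2 < b.2).
Definition wsw (a b : cell) : Prop := b.1 <= a.1 /\ a.2 <= b.2.
Definition sne (a b : cell) : Prop := a.1 < b.1 /\ b.2 < a.2.

Definition chainset (n : nat) (B X : cellset) : Prop :=
  [/\ (forall x, X x -> B x), trinv n X &
      (forall a b, X a -> X b -> nw a b \/ nw b a)].

Definition channel (n : nat) (B X : cellset) : Prop :=
  chainset n B X /\
  exists k, ncl n X k /\
    (forall (Y : cellset) (k' : nat), chainset n B Y -> ncl n Y k' -> (k' <= k)%N).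

Definition swmost (n : nat) (B C : cellset) : Prop :=
  forall C', channel n B C' -> forall b, C b -> exists b', C' b' /\ wsw b b'.

(* numbering of C by consecutive integers increasing from NW to SE:
   a strictly order-preserving surjection onto Z *)
Definition numbering (C : cellset) (dt : cell -> int) : Prop :=
  (forall a b, C a -> C b -> a <> b -> nw a b -> dt a < dt b) /\
  (forall t : int, exists c, C c /\ dt c = t).

Definition dpath (B C : cellset) (b : cell) (s : seq cell) : Prop :=
  [/\ (forall x, x \in s -> B x), path (fun x y => snwb y x) b s & C (last b s)].

Definition dval (B C : cellset) (dt : cell -> int) (b : cell) (t : int) : Prop :=
  (exists s, dpath B C b s /\ dt (last b s) + (size s)%:Z = t) /\
  (forall s, dpath B C b s -> dt (last b s) + (size s)%:Z <= t).

Definition level (B C : cellset) (dt : cell -> int) (t : int) : cellset :=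
  fun x => B x /\ dval B C dt x t.

Definition outer_corner (L : cellset) (x : cell) : Prop :=
  exists a b, [/\ L a, L b, a.1 < b.1,
    (forall c, L c -> ~ (a.1 < c.1 /\ c.1 < b.1)) & x = (b.1, a.2)].

Definition back_corner (L : cellset) (x : cell) : Prop :=
  exists a b, [/\ L a, L b, (forall c, L c -> a.1 <= c.1),
    (forall c, L c -> c.1 <= b.1) & x = (a.1, b.2)].

Definition ambc_step (n : nat) (B B' S : cellset) : Prop :=
  exists (C : cellset) (dt : cell -> int),
    [/\ channel n B C, swmost n B C, numbering C dt,
        (forall x, B' x <-> exists t, outer_corner (level B C dt t) x) &
        (forall x, S x <-> exists t, back_corner (level B C dt t) x)].

Definition resid (n : nat) (c : int) : nat := absz (((c - 1) %% n%:Z)%Z + 1).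

Definition ceilz (n : nat) (c : int) : int := - ((- c) %/ n%:Z)%Z.

(* a row of a tabloid is a duplicate-free list of elements of {1..n} *)
Definition tabrow := seq nat.
Definition tabloid := seq tabrow.

Definition rec_rows (n : nat) (S : cellset) (p q : tabrow) : Prop :=
  [/\ uniq p, uniq q,
      (forall r : nat, r \in p <-> exists c, S c /\ resid n c.2 = r) &
      (forall r : nat, r \in q <-> exists c, S c /\ resid n c.1 = r)].

Definition rec_rho (n : nat) (S : cellset) (r : int) (l : nat) : Prop :=
  exists s : seq cell,
    [/\ uniq s, (forall x, x \in s <-> S x /\ (1 <= x.1 <= n%:Z)),
        size s = l & r = \sum_(c <- s) (ceilz n c.2 - ceilz n c.1)].

(* AMBC n B P Q rho lam : iterating AMBC on the partial permutation B
   (given by its set of balls) terminates and outputs (P, Q, rho),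
   lam being the common shape *)
Inductive AMBC (n : nat) : cellset -> tabloid -> tabloid -> seq int -> seq nat -> Prop :=
| AMBC_nil (B : cellset) : (forall x, ~ B x) -> AMBC n B [::] [::] [::] [::]
| AMBC_cons (B B' S : cellset) p q r l P Q rho lam :
    (exists x, B x) -> ambc_step n B B' S -> rec_rows n S p q -> rec_rho n S r l ->
    AMBC n B' P Q rho lam -> AMBC n B (p :: P) (q :: Q) (r :: rho) (l :: lam).

Definition graph (f : int -> int) : cellset := fun x => f x.1 = x.2.

(* length: number of translation classes of pairs (a, b) of balls with
   a strictly northeast of b (representatives: row of a in [1, n]) *)
Definition affine_length (n : nat) (f : int -> int) (l : nat) : Prop :=
  ncard (fun ab : cell * cell =>
           [/\ graph f ab.1, graph f ab.2, sne ab.1 ab.2 & 1 <= ab.1.1 <= n%:Z]) l.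

Definition rowidx (T : tabloid) (x : nat) : nat := find (fun R => x \in R) T.

Definition inv_tab (n : nat) (T : tabloid) : nat :=
  \sum_(1 <= i < n.+1) \sum_(i.+1 <= j < n.+1) (rowidx T j < rowidx T i)%N.

(* inv(lambda) = lambda_2 + lambda_4 + ... *)
Definition inv_part (lam : seq nat) : nat :=
  \sum_(i < size lam | odd i) nth 0%N lam i.

Definition inv_rho (lam : seq nat) (rho : seq int) : int :=
  \sum_(i < size lam | odd (nth 0%N lam i)) nth 0 rho i.

Definition m1pow (z : int) : int := (-1) ^+ absz z.

(* Main.v *)
Require Import Defs.
From mathcomp Require Import all_boot all_order all_algebra.
From mathcomp Require Import zify ring boolp.
Set Implicit Arguments.
Unset Strict Implicit.
Unset Printing Implicit Defensive.
Import Order.TTheory GRing.Theory Num.Theory.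
Local Open Scope ring_scope.

(** Write [w i = sigma i + n a_i] on [1..n], with [sigma] a permutation of [1..n]. The
    left-hand side is the parity of [inv sigma + \sum_i a_i], the twisted parity of [w].
    Indeed [\sum_i (w i - i) = n \sum_i a_i], and the length, which by Shi's formula is
    [\sum_(i < j) |floor ((w j - w i) / n)|], has the parity of [inv sigma + (n - 1) \sum_i a_i]:
    modulo 2 the floor of [(y - x) / n] is the sum of the ceilings of [x / n] and [y / n],
    plus 1 if the residues of [x] and [y] are inverted.

    One step of AMBC replaces the balls of each level by its back corner and its outer
    corners. These have the same rows, and their columns are those of the level rotated by
    one, so the twisted parity changes by (number of balls) - (number of levels); these
    numbers add up to [inv lam] modulo 2. Separating the back corners from the outer corners
    contributes the inversions between one row and the lower rows of [P] and of [Q]. The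
    back corners form a chain, along which both coordinates increase by less than [n] within
    one period, so all floors vanish and the twisted parity is [lam_1 * rho_1].

    The distance [d] to a channel is finite because a closed walk of [k] steps that winds
    [N] times around the cylinder satisfies [k <= N m], where [m] is the size of a channel:
    the [N] translates of the walk can be sorted into [N] chains that wind only once. *)

(** * Sums over pairs, inversions and parities *)

Section PairSum.
Variable V : nmodType.

Fixpoint pair_sum (T : Type) (F : T -> T -> V) (s : seq T) : V :=
  if s is x :: s' then \sum_(y <- s') F x y + pair_sum F s' else 0.

Lemma pair_sum_cat (T : Type) (F : T -> T -> V) s t :
  pair_sum F (s ++ t) =
  pair_sum F s + pair_sum F t + \sum_(x <- s) \sum_(y <- t) F x y.
Proof.
elim: s => [|x s IH] /=; first by rewrite big_nil addr0 add0r.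
by rewrite IH big_cat big_cons /= addrACA -!addrA [X in _ + (_ + X)]addrCA.
Qed.

Lemma pair_sum_map (T U : Type) (h : U -> T) (F : T -> T -> V) s :
  pair_sum F (map h s) = pair_sum (fun x y => F (h x) (h y)) s.
Proof. by elim: s => //= x s ->; rewrite big_map. Qed.

Lemma pair_sumD (T : Type) (F G : T -> T -> V) s :
  pair_sum (fun x y => F x y + G x y) s = pair_sum F s + pair_sum G s.
Proof. by elim: s => [|x s IH] /=; rewrite ?addr0 // IH big_split addrACA. Qed.

Lemma pair_sum_add_weights (T : Type) (c : T -> V) s :
  pair_sum (fun x y => c x + c y) s = (\sum_(x <- s) c x) *+ (size s).-1.
Proof.
elim: s => //= x s IH.
rewrite IH big_split big_const_seq count_predT iter_addr_0 /= big_cons mulrnDl -addrA.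
by case: s {IH} => [|y s] /=; rewrite -?mulrS // big_nil mul0rn addr0.
Qed.

Lemma sum_sum_pair_sum (T : Type) (F : T -> T -> V) s :
  \sum_(x <- s) \sum_(y <- s) F x y =
  \sum_(x <- s) F x x + pair_sum (fun x y => F x y + F y x) s.
Proof.
elim: s => [|x s IH] /=; first by rewrite !big_nil addr0.
rewrite !big_cons; under [X in _ + X]eq_bigr do rewrite big_cons.
by rewrite !big_split /= IH [X in _ + X = _]addrCA addrACA (addrA (\sum_(y <- s) F x y)).
Qed.

Lemma eq_pair_sum (T : eqType) (r : rel T) (F G : T -> T -> V) s :
    pairwise r s -> {in s &, forall x y, r x y -> F x y = G x y} ->
  pair_sum F s = pair_sum G s.
Proof.
elim: s => //= x s IH /andP[/allP rx /IH{}IH] FG; congr (_ + _).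
  by apply: eq_big_seq => y ys; rewrite FG ?rx ?inE ?ys ?eqxx ?orbT.
by apply: IH => y z ys zs; apply: FG; rewrite inE ?ys ?zs orbT.
Qed.

Lemma perm_pair_sum (T : eqType) (F : T -> T -> V) s t :
    {in s &, forall x y, F x y = F y x} -> perm_eq s t ->
  pair_sum F s = pair_sum F t.
Proof.
move=> Fsym st; suff [] : perm_eq s t /\ pair_sum F s = pair_sum F t by [].
apply: (catCA_perm_ind (P := fun t => perm_eq s t /\ _) _ st) => //.
move=> s1 s2 s3 [p ->]; split; first by rewrite (perm_trans p) // perm_catCA.
rewrite !catA !pair_sum_cat; congr (_ + _ + _); last exact/perm_big/permEl/perm_catC.
rewrite [in RHS]exchange_big /= [pair_sum F s2 + _]addrC; congr (_ + _).
apply: eq_big_seq => x x1; apply: eq_big_seq => y y2.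
by apply: Fsym; rewrite (perm_mem p) !mem_cat ?x1 ?y2 ?orbT.
Qed.
End PairSum.

Lemma raddf_pair_sum (V W : nmodType) (f : {additive V -> W}) (T : Type)
    (F : T -> T -> V) s :
  f (pair_sum F s) = pair_sum (fun x y => f (F x y)) s.
Proof. by elim: s => [|x s IH] /=; rewrite ?raddf0 // raddfD raddf_sum IH. Qed.

Lemma uniq_map_inj_in (T U : eqType) (f : T -> U) (s : seq T) :
  uniq (map f s) -> {in s &, injective f}.
Proof.
elim: s => //= x s IH /andP[/mapP fx /IH{}IH] y z; rewrite !inE.
move=> /predU1P[->|ys] /predU1P[->|zs] e //; last exact: IH.
  by case: fx; exists z.
by case: fx; exists y.
Qed.

(* Parities are computed in the two-element field bool, where [n%:R] and [z%:~R] are the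
   parities of [n : nat] and [z : int]. *)
Lemma natr2_bool : 2 = 0 :> bool.
Proof. by []. Qed.

Lemma intrB_bool (a b : int) : (a - b)%:~R = (a + b)%:~R :> bool.
Proof. by rewrite intrB intrD GRing.subr_pchar2. Qed.

Lemma natr_bool (b : bool) : b%:R = b :> bool.
Proof. by case: b. Qed.

Lemma natr_odd k : k%:R = odd k :> bool.
Proof. by elim: k => //= k <-; rewrite mulrS. Qed.

Lemma natr_absz (z : int) : `|z|%:R = z%:~R :> bool.
Proof.
case: z => k; first exact: pmulrn.
by rewrite NegzE abszN mulrNz (@oppr_pchar2 bool) // -pmulrn.
Qed.

Lemma m1pow_intr (z : int) : m1pow z = (-1) ^+ (z%:~R : bool).
Proof. by rewrite -natr_absz natr_odd signr_odd. Qed.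

Section Inversions.
Context {d : Order.disp_t} {T : orderType d}.
Implicit Types s t : seq T.

Definition inversions s : nat := pair_sum (fun x y : T => (y < x)%O : nat) s.

Definition cross_inversions s t : nat :=
  (\sum_(x <- s) \sum_(y <- t) (y < x)%O)%N.

Lemma inversions_cat s t :
  inversions (s ++ t) =
  (inversions s + inversions t + cross_inversions s t)%N.
Proof. exact: pair_sum_cat. Qed.

Lemma cross_inversions_flatten s (ss : seq (seq T)) :
  cross_inversions s (flatten ss) = (\sum_(t <- ss) cross_inversions s t)%N.
Proof.
rewrite /cross_inversions [RHS]exchange_big /=; apply: eq_bigr => x _.
by elim: ss => [|t ss IH]; rewrite ?big_nil // big_cons big_cat IH.
Qed.

Lemma perm_cross_inversions s s' t t' : perm_eq s s' -> perm_eq t t' ->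
  cross_inversions s t = cross_inversions s' t'.
Proof.
move=> ps pt; rewrite /cross_inversions (perm_big _ ps) /=.
by apply: eq_bigr => x _; apply: perm_big.
Qed.

Lemma cross_inversionsC s t : uniq (s ++ t) ->
  (cross_inversions s t + cross_inversions t s)%N = (size s * size t)%N.
Proof.
rewrite cat_uniq => /and3P[_ /hasPn st _].
rewrite [cross_inversions t s]exchange_big -big_split /=.
transitivity (\sum_(x <- s) size t)%N; last first.
  by rewrite big_const_seq count_predT iter_addn_0 mulnC.
apply: eq_big_seq => x xs; rewrite -big_split -sum1_size /=.
by apply: eq_big_seq => y /st; case: ltgtP => // ->; rewrite xs.
Qed.

Lemma inversions_rotr1 s : uniq s ->
  (inversions (rotr 1 s))%:R = (inversions s)%:R + (size s).-1%:R :> bool.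
Proof.
case/lastP: s => [|s x] // us; rewrite rotr1_rcons size_rcons /=.
move: us; rewrite -cats1 -[x :: s]cat1s => /cross_inversionsC.
rewrite muln1 !inversions_cat => <-; rewrite !natrD.
ring: natr2_bool.
Qed.

Lemma natr_inversions_map (U : Type) (h : U -> T) (s : seq U) :
  (inversions (map h s))%:R = pair_sum (fun x y => (h y < h x)%O) s :> bool.
Proof.
rewrite /inversions pair_sum_map raddf_pair_sum; congr pair_sum.
by apply/funext => x; apply/funext => y; exact: natr_bool.
Qed.

(* Whether two places are inverted in exactly one of the two words does not depend on
   which of the places comes first. *)
Lemma perm_inversions2 (U : eqType) (g h : U -> T) (s t : seq U) :
    perm_eq s t -> uniq (map g s) -> uniq (map h s) ->
  (inversions (map g s))%:R + (inversions (map h s))%:R =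
  (inversions (map g t))%:R + (inversions (map h t))%:R :> bool.
Proof.
move=> st ug uh; rewrite !natr_inversions_map -!pair_sumD.
apply: perm_pair_sum st => x y xs ys.
case: (eqVneq x y) => [-> //|xy].
have gxy : g x != g y by apply: contra_neq xy; apply: (uniq_map_inj_in ug).
have hxy : h x != h y by apply: contra_neq xy; apply: (uniq_map_inj_in uh).
by case: (ltgtP (g x)) gxy; case: (ltgtP (h x)) hxy.
Qed.
End Inversions.

Lemma perm_flatten_rotr1 (T : eqType) (ss : seq (seq T)) :
  perm_eq (flatten [seq rotr 1 s | s <- ss]) (flatten ss).
Proof. by elim: ss => //= s ss IH; rewrite perm_cat // perm_rotr. Qed.

Lemma inversions_flatten_rotr1 {d : Order.disp_t} {T : orderType d}
    (ss : seq (seq T)) :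
    uniq (flatten ss) ->
  (inversions (flatten [seq rotr 1 s | s <- ss]))%:R =
  (inversions (flatten ss))%:R + (\sum_(s <- ss) (size s).-1)%:R :> bool.
Proof.
elim: ss => [|s ss IH] /=; first by rewrite big_nil addr0.
rewrite cat_uniq big_cons => /and3P[us _ /IH{}IH].
rewrite (inversions_cat (rotr 1 s)) (inversions_cat s).
have -> : cross_inversions (rotr 1 s) (flatten [seq rotr 1 s | s <- ss]) =
          cross_inversions s (flatten ss).
  by apply: perm_cross_inversions; rewrite ?perm_rotr ?perm_flatten_rotr1.
rewrite !natrD IH (inversions_rotr1 us); ring.
Qed.

(** * Residues, ceilings and sums of floors *)

Section Residues.
Variable n : nat.
Hypothesis n_gt0 : (0 < n)%N.

Lemma ceilzE (c : int) : ceilz n c = ((c - 1) %/ n)%Z + 1.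
Proof.
have n0 : n%:Z != 0 by lia.
have cE := divz_eq (c - 1) n; have := modz_ge0 (c - 1) n0.
have := ltz_pmod (c - 1) (d := n%:Z) n_gt0.
rewrite /ceilz; move: cE; set q := divz _ _; set r := modz _ _ => cE r_lt r_ge0.
have -> : - c = - (q + 1) * n + (n%:Z - 1 - r) by rewrite mulNr mulrDl; lia.
by rewrite divzMDl // divz_small; lia.
Qed.

Lemma ceilz_resid_eq (c : int) : c = (ceilz n c - 1) * n + resid n c.
Proof.
have := modz_ge0 (c - 1) (d := n); have := divz_eq (c - 1) n.
rewrite ceilzE /resid addrK; lia.
Qed.

Lemma resid_range (c : int) : (0 < resid n c <= n)%N.
Proof.
have := modz_ge0 (c - 1) (d := n); have := ltz_pmod (c - 1) (d := n).
rewrite /resid; lia.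
Qed.

Lemma ceilz_shift (c k : int) : ceilz n (c + k * n) = ceilz n c + k.
Proof.
rewrite !ceilzE (_ : c + _ - 1 = k * n%:Z + (c - 1)); last by ring.
by rewrite divzMDl; [ring | lia].
Qed.

Lemma resid_shift (c k : int) : resid n (c + k * n) = resid n c.
Proof.
by rewrite /resid (_ : c + _ - 1 = k * n%:Z + (c - 1)) ?modzMDl //; ring.
Qed.

Lemma ceilz_small (c : int) : 1 <= c <= n%:Z -> ceilz n c = 1.
Proof. by move=> c_small; rewrite ceilzE divz_small //; lia. Qed.

Lemma resid_small (i : nat) : (0 < i <= n)%N -> resid n i = i.
Proof. by move=> i_small; rewrite /resid modz_small; lia. Qed.

Lemma eq_resid (a b : int) :
  resid n a = resid n b -> a = b + (ceilz n a - ceilz n b) * n.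
Proof.
by have := ceilz_resid_eq b; have := ceilz_resid_eq a; rewrite !mulrBl; lia.
Qed.

Lemma divz_sub_ceilz (x y : int) :
  ((y - x) %/ n)%Z = ceilz n y - ceilz n x - (resid n y < resid n x)%N%:Z.
Proof.
have n0 : n%:Z != 0 by lia.
have xr := resid_range x; have yr := resid_range y.
rewrite {1}(ceilz_resid_eq x) {1}(ceilz_resid_eq y).
move: (ceilz n x) (ceilz n y) (resid n x) (resid n y) xr yr => cx cy rx ry xr yr.
set b := (_ < _)%N.
have -> : (cy - 1) * n%:Z + ry%:Z - ((cx - 1) * n%:Z + rx%:Z) =
          (cy - cx - b%:Z) * n%:Z + (ry%:Z - rx%:Z + b%:Z * n%:Z) by ring.
by rewrite divzMDl // divz_small ?addr0 // /b; case: ltnP; lia.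
Qed.
End Residues.

Definition floor_sum (n : nat) (s : seq int) : int :=
  pair_sum (fun x y => ((y - x) %/ n)%Z) s.

Lemma floor_sum0 n s : pairwise (fun x y : int => 0 <= y - x < n%:Z) s -> floor_sum n s = 0.
Proof.
rewrite /floor_sum; elim: s => //= x s IH /andP[/allP xs /IH->].
by rewrite addr0 big1_seq // => y /xs yx; rewrite divz_small.
Qed.

Lemma intr_floor_sum n s : (0 < n)%N ->
  (floor_sum n s)%:~R = (inversions (map (resid n) s))%:R +
    (size s).-1%:R * (\sum_(x <- s) ceilz n x)%:~R :> bool.
Proof.
move=> n_gt0; rewrite natr_inversions_map raddf_pair_sum /=.
rewrite mulr_natl -rmorphMn -pair_sum_add_weights raddf_pair_sum -pair_sumD.
congr pair_sum; apply/funext => x; apply/funext => y.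
rewrite [LHS](congr1 intr (divz_sub_ceilz n_gt0 x y)) ltEnat.
rewrite -[X in _ = X + _]natr_bool !(intrB_bool, intrD); ring.
Qed.

(** * Balls up to translation *)

Definition translate (n : nat) (k : int) (x : cell) : cell :=
  (x.1 + k * n, x.2 + k * n).

Lemma translate0 n x : translate n 0 x = x.
Proof. by case: x => i j; rewrite /translate mul0r !addr0. Qed.

Lemma translateD n k l x : translate n k (translate n l x) = translate n (k + l) x.
Proof. by rewrite /translate /= -!addrA -mulrDl [l + k]addrC. Qed.

Lemma translateK n k : cancel (translate n k) (translate n (- k)).
Proof. by move=> x; rewrite translateD addNr translate0. Qed.

Lemma translateNK n k : cancel (translate n (- k)) (translate n k).
Proof. by move=> x; rewrite translateD subrr translate0. Qed.

Lemma translate_inj n k : injective (translate n k).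
Proof. exact: can_inj (translateK n k). Qed.

Lemma trinvE n B : trinv n B <-> forall x, B x <-> B (translate n 1 x).
Proof. by split=> BT x; move: (BT x); rewrite /translate mul1r. Qed.

Lemma trinv_translate n B k x : trinv n B -> B (translate n k x) <-> B x.
Proof.
move=> /trinvE BT; elim/int_rect: k => [|k IH|k IH]; first by rewrite translate0.
  by rewrite -addn1 PoszD addrC -translateD -BT.
by rewrite BT translateD -addn1 PoszD opprD addrC addrNK.
Qed.

Lemma snwb_trans : transitive snwb.
Proof.
move=> y x z /andP[xy1 xy2] /andP[yz1 yz2].
by rewrite /snwb (lt_trans xy1) // (lt_trans xy2).
Qed.

Lemma snwb_translate n k x y : snwb (translate n k x) (translate n k y) = snwb x y.
Proof. by rewrite /snwb /translate /= !ltrD2r. Qed.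

Definition row_residues (n : nat) (s : seq cell) : seq nat := [seq resid n x.1 | x <- s].
Definition col_residues (n : nat) (s : seq cell) : seq nat := [seq resid n x.2 | x <- s].

Lemma row_residuesE n s : row_residues n s = map (resid n) (map fst s).
Proof. exact: map_comp. Qed.

Lemma col_residuesE n s : col_residues n s = map (resid n) (map snd s).
Proof. exact: map_comp. Qed.

Lemma row_residues_cat n s t :
  row_residues n (s ++ t) = row_residues n s ++ row_residues n t.
Proof. exact: map_cat. Qed.

Lemma col_residues_cat n s t :
  col_residues n (s ++ t) = col_residues n s ++ col_residues n t.
Proof. exact: map_cat. Qed.

Definition altitude (n : nat) (s : seq cell) : int :=
  \sum_(x <- s) (ceilz n x.2 - ceilz n x.1).

Lemma altitudeE n s :
  altitude n s = \sum_(j <- map snd s) ceilz n j - \sum_(i <- map fst s) ceilz n i.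
Proof. by rewrite /altitude sumrB !big_map. Qed.

(* On the balls of [w] in rows [1..n], where [w i = sigma i + n a_i], this is
   [inv sigma + \sum_i a_i] modulo 2. *)
Definition twisted_parity (n : nat) (s : seq cell) : bool :=
  (inversions (row_residues n s))%:R + (inversions (col_residues n s))%:R +
  (altitude n s)%:~R.

Lemma perm_twisted_parity n s t :
    perm_eq s t -> uniq (row_residues n s) -> uniq (col_residues n s) ->
  twisted_parity n s = twisted_parity n t.
Proof.
move=> st ur uc; rewrite /twisted_parity (perm_inversions2 st ur uc).
by rewrite /altitude (perm_big _ st).
Qed.

Lemma twisted_parity_cat n s t :
  twisted_parity n (s ++ t) = twisted_parity n s + twisted_parity n t +
    (cross_inversions (row_residues n s) (row_residues n t))%:R +
    (cross_inversions (col_residues n s) (col_residues n t))%:R.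
Proof.
rewrite /twisted_parity /altitude big_cat row_residues_cat col_residues_cat.
by rewrite !inversions_cat !natrD intrD /=; ring.
Qed.

Lemma twisted_parity_floor_sum n s : (0 < n)%N ->
  twisted_parity n s = (floor_sum n (map fst s))%:~R + (floor_sum n (map snd s))%:~R +
    (size s)%:R * (altitude n s)%:~R.
Proof.
move=> n_gt0; rewrite /twisted_parity row_residuesE col_residuesE.
rewrite !intr_floor_sum // !size_map altitudeE intrB_bool intrD.
case: s => [|x s] /=; last by rewrite mulrS; ring: natr2_bool.
by rewrite !big_nil; ring: natr2_bool.
Qed.

Definition ball_reps (n : nat) (B : cellset) (s : seq cell) : Prop :=
  [/\ forall x, B x <-> exists2 y, y \in s & exists k : int, x = translate n k y,
      uniq (row_residues n s) & uniq (col_residues n s)].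

Lemma mem_ball_reps n B s x : ball_reps n B s -> x \in s -> B x.
Proof. by move=> [Bs _ _] xs; apply/Bs; exists x => //; exists 0; rewrite translate0. Qed.

Definition partial_perm (n : nat) (B : cellset) : Prop :=
  [/\ trinv n B, forall x y, B x -> B y -> x.1 = y.1 -> x = y &
      forall x y, B x -> B y -> x.2 = y.2 -> x = y].

Section Translates.
Variable n : nat.
Hypothesis n_gt0 : (0 < n)%N.

Lemma row_residues_translate (k : cell -> int) s :
  row_residues n [seq translate n (k x) x | x <- s] = row_residues n s.
Proof. by rewrite /row_residues -map_comp; apply: eq_map => x /=; rewrite resid_shift. Qed.

Lemma col_residues_translate (k : cell -> int) s :
  col_residues n [seq translate n (k x) x | x <- s] = col_residues n s.
Proof. by rewrite /col_residues -map_comp; apply: eq_map => x /=; rewrite resid_shift. Qed.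

Lemma twisted_parity_translate (k : cell -> int) s :
  twisted_parity n [seq translate n (k x) x | x <- s] = twisted_parity n s.
Proof.
rewrite /twisted_parity row_residues_translate col_residues_translate.
congr (_ + intr _); rewrite /altitude big_map; apply: eq_bigr => x _.
by rewrite !ceilz_shift //; ring.
Qed.

Lemma ball_reps_partial_perm B s : ball_reps n B s -> partial_perm n B.
Proof.
move=> [Bs ur uc].
have coord_inj (p : cell -> int) : (forall k x, p (translate n k x) = p x + k * n) ->
    uniq [seq resid n (p x) | x <- s] -> forall x y, B x -> B y -> p x = p y -> x = y.
  move=> pt up _ _ /Bs[y ys [k ->]] /Bs[z zs [l ->]]; rewrite !pt => e.
  have yz : y = z.
    by apply: (uniq_map_inj_in up); rewrite // -(resid_shift n _ k) e resid_shift.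
  congr translate => //; move: e; rewrite yz => /(congr1 (ceilz n)).
  by rewrite !ceilz_shift //; lia.
split; [|exact: coord_inj ur|exact: coord_inj uc].
apply/trinvE => x; split=> /Bs[y ys [k e]]; apply/Bs; exists y => //.
  by exists (1 + k); rewrite e translateD.
by exists (- 1 + k); rewrite -translateD -e translateK.
Qed.

Definition normalize (x : cell) : cell := translate n (1 - ceilz n x.1) x.

Lemma normalize_translate k x : normalize (translate n k x) = normalize x.
Proof. by rewrite /normalize ceilz_shift // translateD; congr translate; ring. Qed.

Lemma normalize_row x : 1 <= (normalize x).1 <= n%:Z.
Proof.
have := ceilz_resid_eq n_gt0 x.1; have := resid_range n_gt0 x.1.
rewrite /normalize /translate /= mulrBl mul1r; lia.
Qed.

Lemma normalize_id x : 1 <= x.1 <= n%:Z -> normalize x = x.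
Proof. by move=> /(ceilz_small n_gt0) e; rewrite /normalize e translate0. Qed.

Lemma perm_normalize B s t :
  ball_reps n B s -> ball_reps n B t -> perm_eq (map normalize s) (map normalize t).
Proof.
have normalize_sub s1 s2 : ball_reps n B s1 -> ball_reps n B s2 ->
    {subset map normalize s1 <= map normalize s2}.
  move=> B1 [B2 _ _] _ /mapP[x xs ->].
  have /B2[y ys [k ->]] := mem_ball_reps B1 xs.
  by rewrite normalize_translate; apply: map_f.
have normalize_uniq s' : ball_reps n B s' -> uniq (map normalize s').
  case=> _ + _; rewrite -(row_residues_translate (fun x => 1 - ceilz n x.1)).
  exact: map_uniq.
move=> Bs Bt; apply: uniq_perm; [exact: normalize_uniq..|] => x.
by apply/idP/idP; apply: normalize_sub.
Qed.

Lemma perm_ball_reps B s t : ball_reps n B s -> ball_reps n B t ->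
  [/\ perm_eq (row_residues n s) (row_residues n t),
      perm_eq (col_residues n s) (col_residues n t) &
      twisted_parity n s = twisted_parity n t].
Proof.
move=> Bs Bt; have st := perm_normalize Bs Bt; have [_ ur uc] := Bs.
pose k (x : cell) := 1 - ceilz n x.1; split.
- by rewrite -(row_residues_translate k s) -(row_residues_translate k t) perm_map.
- by rewrite -(col_residues_translate k s) -(col_residues_translate k t) perm_map.
rewrite -(twisted_parity_translate k s) -(twisted_parity_translate k t).
by apply: perm_twisted_parity; rewrite ?row_residues_translate ?col_residues_translate.
Qed.
End Translates.

(** * Zigzags *)

Definition outer_cells (s : seq cell) : seq cell :=
  if s is x :: s' then pairmap (fun a b => (b.1, a.2)) x s' else [::].

Definition back_cell (s : seq cell) : cell :=
  ((head (0, 0) s).1, (last (0, 0) s).2).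

Definition zigzag (s : seq cell) : seq cell :=
  if s is [::] then [::] else back_cell s :: outer_cells s.

Lemma size_outer_cells s : size (outer_cells s) = (size s).-1.
Proof. by case: s => //= x s; rewrite size_pairmap. Qed.

Lemma zigzag_rows s : map fst (zigzag s) = map fst s.
Proof. by case: s => //= x s; congr cons; elim: s x => //= y s IH x; rewrite IH. Qed.

Lemma zigzag_cols s : map snd (zigzag s) = rotr 1 (map snd s).
Proof.
case: s => // x s; rewrite [x :: s in RHS]lastI map_rcons rotr1_rcons /=.
by congr cons; elim: s x => //= y s IH x; rewrite IH.
Qed.

Lemma translate_outer_cells n k s :
  outer_cells (map (translate n k) s) = map (translate n k) (outer_cells s).
Proof. by case: s => //= x s; elim: s x => //= y s IH x; rewrite IH. Qed.

Lemma translate_back_cell n k s : s != [::] ->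
  back_cell (map (translate n k) s) = translate n k (back_cell s).
Proof. by case: s => //= x s _; rewrite /back_cell /= last_map. Qed.

Lemma perm_flatten_zigzag (ss : seq (seq cell)) : [::] \notin ss ->
  perm_eq (flatten (map zigzag ss)) (map back_cell ss ++ flatten (map outer_cells ss)).
Proof.
elim: ss => [|[|x s] ss IH] //= /IH{}IH.
by rewrite perm_cons perm_sym perm_catCA perm_cat2l perm_sym.
Qed.

Lemma flatten_zigzag_rows (ss : seq (seq cell)) :
  map fst (flatten (map zigzag ss)) = map fst (flatten ss).
Proof.
rewrite !map_flatten -map_comp; congr flatten.
by apply: eq_map => s /=; apply: zigzag_rows.
Qed.

Lemma flatten_zigzag_cols (ss : seq (seq cell)) :
  map snd (flatten (map zigzag ss)) = flatten [seq rotr 1 s | s <- map (map snd) ss].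
Proof.
rewrite map_flatten -!map_comp; congr flatten.
by apply: eq_map => s /=; apply: zigzag_cols.
Qed.

Lemma perm_flatten_zigzag_cols (ss : seq (seq cell)) :
  perm_eq (map snd (flatten (map zigzag ss))) (map snd (flatten ss)).
Proof. by rewrite flatten_zigzag_cols [X in perm_eq _ X]map_flatten perm_flatten_rotr1. Qed.

Lemma twisted_parity_zigzag n (ss : seq (seq cell)) :
    uniq (col_residues n (flatten ss)) ->
  twisted_parity n (flatten ss) =
  twisted_parity n (flatten (map zigzag ss)) + (size (flatten (map outer_cells ss)))%:R.
Proof.
have -> : size (flatten (map outer_cells ss)) =
    (\sum_(s <- map (col_residues n) ss) (size s).-1)%N.
  rewrite size_flatten /shape -map_comp sumnE !big_map; apply: eq_bigr => s _.
  by rewrite size_map; apply: size_outer_cells.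
have col_residues_flatten : col_residues n (flatten ss) = flatten (map (col_residues n) ss).
  exact: map_flatten.
have col_residues_zigzag : col_residues n (flatten (map zigzag ss)) =
    flatten [seq rotr 1 s | s <- map (col_residues n) ss].
  rewrite col_residuesE flatten_zigzag_cols map_flatten -!map_comp; congr flatten.
  by apply: eq_map => s /=; rewrite map_rotr col_residuesE.
rewrite col_residues_flatten => /inversions_flatten_rotr1.
rewrite -col_residues_zigzag -col_residues_flatten.
rewrite /twisted_parity => ->; rewrite !altitudeE !row_residuesE flatten_zigzag_rows.
by rewrite (perm_big _ (perm_flatten_zigzag_cols ss)) /=; ring: natr2_bool.
Qed.

Section SortedCells.
Variables (L : cellset) (s : seq cell).
Hypothesis Ls : forall x, L x <-> x \in s.
Hypothesis s_sorted : sorted <%R (map fst s).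

Lemma outer_corner_sorted c : outer_corner L c <-> c \in outer_cells s.
Proof.
case: s Ls s_sorted => [|x s'] Lxs xs_sorted.
  by split=> // -[a [b [/Lxs]]].
have row_nth i j : (i < size (x :: s'))%N -> (j < size (x :: s'))%N ->
    ((nth x (x :: s') i).1 < (nth x (x :: s') j).1) = (i < j)%N.
  move=> si sj; rewrite -!(nth_map x x.1 fst) //.
  by apply: (lt_sorted_ltn_nth x.1 xs_sorted); rewrite inE size_map.
split=> [[a [b [/Lxs/(nthP x)[i si <-] /Lxs/(nthP x)[j sj <-] + no_between ->]]]|].
  rewrite row_nth // => ij; have [ij1|ij1] := ltnP i.+1 j.
    case: (no_between (nth x (x :: s') i.+1)); first exact/Lxs/mem_nth/(ltn_trans ij1 sj).
    by split; rewrite row_nth // (ltn_trans _ sj).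
  have {ij ij1 no_between} jE : j = i.+1 by lia.
  rewrite {}jE /= in sj *.
  rewrite -(nth_pairmap x x (fun a b : cell => (b.1, a.2)) sj x).
  by rewrite mem_nth // size_pairmap.
move=> /(nthP x)[i]; rewrite size_pairmap => si <-.
have si1 : (i < size (x :: s'))%N by exact: ltnW.
exists (nth x (x :: s') i), (nth x (x :: s') i.+1); split.
- exact/Lxs/mem_nth.
- exact/Lxs/mem_nth.
- by rewrite row_nth.
- by move=> _ /Lxs/(nthP x)[j sj <-]; rewrite !row_nth //; lia.
- by rewrite (nth_pairmap x).
Qed.

Hypothesis s_neq0 : s != [::].

Lemma mem_head_last : head (0, 0) s \in s /\ last (0, 0) s \in s.
Proof. by case: s s_neq0 => // x s' _; rewrite /= mem_head mem_last. Qed.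

Lemma head_row_min x : x \in s -> (head (0, 0) s).1 <= x.1.
Proof.
case: s s_sorted => //= y s' ys; rewrite inE => /predU1P[->//|xs]; apply: ltW.
by apply: (allP (order_path_min lt_trans ys)); apply: map_f.
Qed.

Lemma last_row_max x : x \in s -> x.1 <= (last (0, 0) s).1 ?= iff (x == last (0, 0) s).
Proof.
case/lastP: s s_sorted => // s' y; rewrite lt_sorted_pairwise map_rcons pairwise_rcons.
rewrite last_rcons mem_rcons inE => /andP[/allP s'y _].
case: eqVneq => [-> _|xy /= xs]; first exact: leif_refl.
have {s'y xs} := s'y _ (map_f fst xs) => xy1.
by split; [exact: ltW | rewrite lt_eqF].
Qed.

Lemma back_corner_sorted c : back_corner L c <-> c = back_cell s.
Proof.
have [s_head s_last] := mem_head_last.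
split=> [[a [b [/Ls sa /Ls sb a_min b_max ->]]]|->]; last first.
  exists (head (0, 0) s), (last (0, 0) s); split=> //; try exact/Ls.
    by move=> x /Ls/head_row_min.
  by move=> x /Ls/last_row_max[].
congr pair; first by apply/eqP; rewrite eq_le head_row_min // a_min //; apply/Ls.
congr snd; apply/eqP; rewrite -(last_row_max sb).2 eq_le (last_row_max sb).1.
by apply: b_max; apply/Ls.
Qed.
End SortedCells.

(** * Closed walks on the cylinder *)

Lemma homo_ltz (T : Type) (u : int -> T) (r : T -> T -> Prop) :
    (forall y x z, r x y -> r y z -> r x z) -> (forall i : int, r (u i) (u (i + 1))) ->
  {homo u : i j / i < j >-> r i j}.
Proof.
move=> r_trans uS i j ij; have -> : j = i + (`|j - i|.-1).+1%:Z by lia.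
elim: (`|j - i|.-1) => [|k IH]; first exact: uS.
by apply: r_trans IH _; rewrite -(addn1 k.+1) PoszD addrA; apply: uS.
Qed.

Definition iotaz (a : int) (k : nat) : seq int := [seq a + i%:Z | i <- iota 0 k].

Lemma size_iotaz a k : size (iotaz a k) = k.
Proof. by rewrite size_map size_iota. Qed.

Lemma mem_iotaz a k i : (i \in iotaz a k) = (a <= i < a + k%:Z).
Proof.
apply/mapP/idP => [[j + ->]|i_in]; rewrite ?mem_iota; first lia.
by exists `|i - a|%N; rewrite ?mem_iota; lia.
Qed.

Lemma iotaz_sorted a k : sorted <%R (iotaz a k).
Proof.
by apply: (homo_sorted (e := ltn)) (iota_ltn_sorted 0 k) => i j; rewrite /= ltrD2l ltz_nat.
Qed.

Lemma iotaz_uniq a k : uniq (iotaz a k).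
Proof. exact: lt_sorted_uniq (iotaz_sorted a k). Qed.

Lemma iotazS a k : iotaz a k.+1 = a :: iotaz (a + 1) k.
Proof.
rewrite /iotaz /= addr0 -[1%N]/(1 + 0)%N iotaDl -map_comp; congr cons.
by apply: eq_map => i /=; rewrite -addrA.
Qed.

Lemma last_iotaz a k : last a (iotaz (a + 1) k) = a + k%:Z.
Proof. by elim: k a => [|k IH] a; rewrite ?addr0 // iotazS /= IH -addrA -intS. Qed.

Lemma iotaz_cover a k i : (0 < k)%N -> exists c : int, i + c * k%:Z \in iotaz a k.
Proof.
move=> k_gt0; exists (- ((i - a) %/ k)%Z); rewrite mem_iotaz mulNr.
have := ltz_pmod (i - a) (d := k); have := modz_ge0 (i - a) (d := k).
by have := divz_eq (i - a) k; lia.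
Qed.

Definition periodic_chain (n : nat) (B : cellset) (b : int -> cell) (k N : nat) : Prop :=
  [/\ forall i, B (b i), forall i, snwb (b i) (b (i + 1)) &
      forall i : int, b (i + k) = translate n N (b i)].

Section PeriodicChain.
Variables (n : nat) (B : cellset) (b : int -> cell) (k N : nat).
Hypothesis b_chain : periodic_chain n B b k N.

Lemma periodic_chain_homo : {homo b : i j / i < j >-> snwb i j}.
Proof.
by have [_ bS _] := b_chain; apply: (homo_ltz (r := snwb)) => // y x z; apply: snwb_trans.
Qed.

Lemma periodic_chain_mono : {mono b : i j / i < j >-> snwb i j}.
Proof.
move=> i j; case: ltgtP => [/periodic_chain_homo->//|/periodic_chain_homo|->].
  by rewrite /snwb; lia.
by rewrite /snwb ltxx.
Qed.

Lemma periodic_chain_row_mono : {mono (fun i => (b i).1) : i j / i < j}.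
Proof. by apply/leW_mono/le_mono => i j /periodic_chain_homo/andP[]. Qed.

Lemma periodic_chain_inj : injective b.
Proof.
move=> i j e; apply/eqP; rewrite eq_le !leNgt -!periodic_chain_mono e.
by rewrite /snwb ltxx.
Qed.

Lemma periodic_chain_uniq a l : uniq (map b (iotaz a l)).
Proof. by rewrite map_inj_uniq ?iotaz_uniq //; apply: periodic_chain_inj. Qed.

Lemma periodic_chain_translate (i c : int) : b (i + c * k) = translate n (c * N) (b i).
Proof.
have [_ _ bk] := b_chain; elim/int_rect: c => [|c IH|c IH].
- by rewrite !mul0r addr0 translate0.
- by rewrite intS !mulrDl !mul1r [k%:Z + _]addrC addrA bk IH translateD.
- apply: (@translate_inj n N); rewrite -bk translateD.
  rewrite (_ : i + _ + k = i + - c%:Z * k); last by rewrite intS; ring.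
  by rewrite IH; congr translate; rewrite intS; ring.
Qed.
End PeriodicChain.

Lemma incr_threshold (u : int -> int) (h : int) :
  {mono u : i j / i < j} -> exists a : int, forall i : int, (h <= u i) = (a <= i).
Proof.
move=> u_mono.
have grows : {homo (fun i => u i - i) : i j / i < j >-> i <= j}.
  apply: homo_ltz => [y x z|i]; first exact: le_trans.
  by have := u_mono i (i + 1); lia.
have [i0 u_i0] : exists i0, u i0 < h.
  by exists (- (`|u 0| + `|h| + 1)); have /= := grows (- (`|u 0| + `|h| + 1)) 0; lia.
have [k0 u_k0] : exists k0 : nat, h <= u (i0 + k0%:Z).
  by exists `|u i0 - h|.+1; have /= := grows i0 (i0 + `|u i0 - h|.+1%:Z); lia.
case: (ex_minnP (ex_intro (fun k : nat => h <= u (i0 + k%:Z)) k0 u_k0)) => k u_k k_min.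
exists (i0 + k%:Z) => i; apply/idP/idP => [u_i|].
  have i0i : i0 < i by rewrite -u_mono (lt_le_trans u_i0).
  have := k_min `|i - i0|%N; rewrite (_ : i0 + _ = i); lia.
by rewrite le_eqVlt -u_mono => /predU1P[<-//|/ltW]; apply: le_trans.
Qed.

Lemma periodic_chain_window n B b k N : periodic_chain n B b k N ->
  exists a : int, forall i : int, (1 <= (b i).1 <= (N * n)%N%:Z) = (a <= i < a + k%:Z).
Proof.
move=> b_chain; have [a aP] := incr_threshold 1 (periodic_chain_row_mono b_chain).
exists a => i; rewrite aP; congr andb; have := aP (i - k%:Z).
have := periodic_chain_translate b_chain i (- 1); rewrite !mulN1r => ->.
rewrite /translate /= mulNr -PoszM; lia.
Qed.

Lemma closed_walk_periodic_chain n B N (x : cell) (w : seq cell) :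
    trinv n B -> {in x :: w, forall y, B y} -> path snwb x w ->
    snwb (last x w) (translate n N%:Z x) ->
  exists b, periodic_chain n B b (size w).+1 N.
Proof.
move=> BT wB xw closing; set k := (size w).+1.
pose b (i : int) := translate n (N%:Z * (i %/ k)%Z) (nth x (x :: w) `|(i %% k)%Z|%N).
have bE (q : int) (r : nat) : (r < k)%N ->
    b (q * k + r%:Z) = translate n (N%:Z * q) (nth x (x :: w) r).
  by move=> rk; rewrite /b divzMDl // modzMDl divz_small ?modz_small ?addr0 //; lia.
have divE (i : int) : exists (q : int) (r : nat), (r < k)%N /\ i = q * k + r%:Z.
  exists (i %/ k)%Z, `|(i %% k)%Z|%N; have := divz_eq i k; have := modz_ge0 i (d := k).
  by have := ltz_pmod i (d := k); lia.
exists b; split=> i; have [q [r [rk ->]]] := divE i.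
- by rewrite bE //; apply/trinv_translate/wB/mem_nth.
- rewrite -addrA -(PoszD r 1) addn1 bE //; case: (ltnP r.+1 k) => rk1.
    by rewrite bE // snwb_translate; apply: (pathP x xw); lia.
  rewrite (_ : q * k + r.+1%:Z = (q + 1) * k + 0%:Z); last by rewrite mulrDl; lia.
  rewrite bE // mulrDr mulr1 -translateD snwb_translate.
  by rewrite (_ : r = size w) ?nth_last //; lia.
- rewrite (_ : _ + k%:Z = (q + 1) * k + r%:Z); last by rewrite mulrDl mul1r addrAC.
  by rewrite !bE // translateD mulrDr mulr1 addrC.
Qed.

Lemma sum_nat_shift (F : nat -> nat) N :
  F N = F 0%N -> (\sum_(0 <= j < N) F j.+1 = \sum_(0 <= j < N) F j)%N.
Proof.
case: N => [|N] FN; first by rewrite !big_geq.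
by rewrite big_nat_recr // [RHS]big_nat_recl // FN addnC.
Qed.

Lemma sum_nat_interval N r k : (r + k <= N)%N ->
  (\sum_(0 <= t < N) (r <= t < r + k) = k)%N.
Proof.
move=> rkN; transitivity (size [seq t <- iota 0 N | r <= t < r + k]%N).
  rewrite size_filter -sum1_count [RHS]big_mkcond /index_iota subn0.
  by apply: eq_bigr => t _; case: ifP.
rewrite -[RHS](size_iota r); apply/perm_size/uniq_perm; rewrite ?filter_uniq ?iota_uniq //.
by move=> t; rewrite mem_filter !mem_iota; lia.
Qed.

(* The translates of a periodic chain [b] of winding number [N] are [N] chains on the cylinder.
   Sorting them from southwest to northeast yields [N] chains of winding number 1,
   the layers, which have the same balls with the same total multiplicity. *)
Section Layers.
Variables (n : nat) (B : cellset) (b : int -> cell) (k N : nat).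
Hypotheses (n_gt0 : (0 < n)%N) (k_gt0 : (0 < k)%N) (BT : trinv n B).
Hypothesis b_chain : periodic_chain n B b k N.

Definition on_chain (p : cell) : bool := `[< exists i : int, p = b i >].

Definition east_of_chain (p : cell) : bool :=
  `[< forall i : int, (b i).1 <= p.1 -> (b i).2 < p.2 >].

Definition multiplicity (p : cell) : nat := \sum_(0 <= j < N) on_chain (translate n j p).

Definition rank (p : cell) : nat := \sum_(0 <= j < N) east_of_chain (translate n j p).

Definition layer (t : nat) (p : cell) : bool :=
  (rank p <= t < rank p + multiplicity p)%N.

Lemma on_chain_period p : on_chain (translate n N p) = on_chain p.
Proof.
have bN := periodic_chain_translate b_chain.
apply/asboolP/asboolP => -[i e].
  by exists (i + -1 * k%:Z); rewrite bN -e mulN1r translateK.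
by exists (i + 1 * k%:Z); rewrite bN mul1r e.
Qed.

Lemma east_of_chain_period p : east_of_chain (translate n N p) = east_of_chain p.
Proof.
have bN := periodic_chain_translate b_chain.
apply/asboolP/asboolP => p_east i.
  by have := p_east (i + 1 * k%:Z); rewrite bN mul1r /= lerD2r ltrD2r.
by have := p_east (i + -1 * k%:Z); rewrite bN mulN1r /= mulNr lerBlDr ltrBlDr.
Qed.

Lemma layer_translate t p : layer t (translate n 1 p) = layer t p.
Proof.
have shift (F : cell -> bool) : (forall q, F (translate n N q) = F q) ->
    (\sum_(0 <= j < N) F (translate n j (translate n 1 p)) =
     \sum_(0 <= j < N) F (translate n j p))%N.
  move=> FN; rewrite -[RHS](@sum_nat_shift (fun j => F (translate n j p))).
    by apply: eq_bigr => j _; rewrite translateD addrC -intS.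
  by rewrite translate0 FN.
rewrite /layer /rank /multiplicity !shift //; first exact: on_chain_period.
exact: east_of_chain_period.
Qed.

Lemma east_on_chain_disjoint p : (east_of_chain p + on_chain p <= 1)%N.
Proof.
suff : ~~ (east_of_chain p && on_chain p) by lia.
apply/andP => -[/asboolP p_east /asboolP[i e]].
by have := p_east i; rewrite e lexx ltxx => /(_ isT).
Qed.

Lemma east_or_on_chain p q : p.1 < q.1 -> q.2 <= p.2 ->
  (east_of_chain q + on_chain q <= east_of_chain p)%N.
Proof.
move=> pq1 qp2.
suff : east_of_chain q || on_chain q -> east_of_chain p.
  by have := east_on_chain_disjoint q; lia.
move=> q_cases; apply/asboolP => i bi_p; apply: lt_le_trans qp2.
have bi_q : (b i).1 < q.1 by exact: le_lt_trans bi_p pq1.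
case/orP: q_cases => /asboolP; first by apply; exact: ltW.
case=> j qE; rewrite qE (periodic_chain_row_mono b_chain) in bi_q *.
by have /andP[] := periodic_chain_homo b_chain bi_q.
Qed.

Lemma layer_snwb t p q : layer t p -> layer t q -> p.1 < q.1 -> p.2 < q.2.
Proof.
move=> /andP[pt _] /andP[_ tq] pq1; rewrite ltNge; apply/negP => qp2.
suff : (rank q + multiplicity q <= rank p)%N by lia.
rewrite -big_split; apply: leq_sum => j _.
by apply: east_or_on_chain; rewrite /translate /= ?ltrD2r ?lerD2r.
Qed.

Lemma layer_on_chain t p : layer t p -> exists i j : int, p = translate n j (b i).
Proof.
move=> tp; apply: contrapT => p_off.
suff : multiplicity p = 0%N by move: tp; rewrite /layer; lia.
rewrite /multiplicity big1 // => j _; apply/eqP; rewrite eqb0; apply/asboolP => -[i e].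
by apply: p_off; exists i, (- j%:Z); rewrite -e translateK.
Qed.

Lemma layer_chainset t : chainset n B (fun p => layer t p).
Proof.
have [bB _ _] := b_chain; split.
- by move=> p /layer_on_chain[i [j ->]]; apply/trinv_translate.
- by apply/trinvE => p; rewrite layer_translate.
move=> p q tp tq; have [pq|pq|pq1] := ltgtP p.1 q.1.
- by left; split; apply: ltW => //; apply: (layer_snwb tp tq).
- by right; split; apply: ltW => //; apply: (layer_snwb tq tp).
- by case: (leP p.2 q.2) => [|/ltW] pq2; [left | right]; split=> //; rewrite pq1.
Qed.

Lemma rank_multiplicity_le p : (rank p + multiplicity p <= N)%N.
Proof.
rewrite -big_split -[X in (_ <= X)%N]subn0 -[X in (_ <= X)%N]muln1 -sum_nat_const_nat.
by apply: leq_sum => j _; apply: east_on_chain_disjoint.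
Qed.

Definition chain_classes (a : int) : seq cell :=
  undup [seq normalize n (b i) | i <- iotaz a k].

Lemma layer_ncl a t :
  ncl n (fun p => layer t p) (count (layer t) (chain_classes a)).
Proof.
exists (filter (layer t) (chain_classes a)).
split; rewrite ?size_filter ?filter_uniq ?undup_uniq // => p.
rewrite mem_filter mem_undup; split=> [/andP[tp /mapP[i _ pE]]|[tp p_row]].
  by split=> //; rewrite pE; apply: normalize_row.
rewrite tp /=; have [i [j pE]] := layer_on_chain tp.
have [c ic_window] := iotaz_cover a i k_gt0.
apply/mapP; exists (i + c * k%:Z) => //.
rewrite (periodic_chain_translate b_chain) -(normalize_id n_gt0 p_row) pE.
by rewrite !normalize_translate.
Qed.

Lemma sum_multiplicity_ge a :
    (forall i : int, (1 <= (b i).1 <= (N * n)%N%:Z) = (a <= i < a + k%:Z)) ->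
  (k <= \sum_(p <- chain_classes a) multiplicity p)%N.
Proof.
move=> aP; pose P := [seq translate n j%:Z p | p <- chain_classes a, j <- index_iota 0 N].
suff /(uniq_leq_size (periodic_chain_uniq b_chain a k)) :
    {subset map b (iotaz a k) <= filter on_chain P}.
  by rewrite size_map size_iotaz size_filter -sum1_count big_mkcond big_allpairs_dep.
move=> _ /mapP[i + ->]; rewrite mem_iotaz -aP => b_row.
rewrite mem_filter; apply/andP; split; first by apply/asboolP; exists i.
have := ceilz_resid_eq n_gt0 (b i).1; have := resid_range n_gt0 (b i).1.
move cE : (ceilz n (b i).1 - 1) => c r_range rowE.
have c_range : 0 <= c < N%:Z by nia.
apply/allpairsP; exists (normalize n (b i), `|c|%N); split=> /=.
- by rewrite mem_undup; apply/mapP; exists i; rewrite ?mem_iotaz -?aP.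
- by rewrite mem_index_iota; lia.
by rewrite /normalize translateD (_ : `|c|%N%:Z + _ = 0) ?translate0 //; lia.
Qed.

Lemma winding_bound m :
    (forall Y l, chainset n B Y -> ncl n Y l -> (l <= m)%N) ->
  (k <= N * m)%N.
Proof.
move=> m_max; have [a aP] := periodic_chain_window b_chain.
apply: leq_trans (sum_multiplicity_ge aP) _.
under eq_bigr => p _ do rewrite -(sum_nat_interval (rank_multiplicity_le p)).
rewrite exchange_big -[X in (_ <= X * _)%N]subn0 -sum_nat_const_nat.
apply: leq_sum => t _; apply: leq_trans (m_max _ _ (layer_chainset t) (layer_ncl a t)).
by rewrite -sum1_count [X in (_ <= X)%N]big_mkcond.
Qed.
End Layers.

(** * The distance to a channel *)

Lemma ex_maxz (P : int -> Prop) (M t : int) :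
  P t -> (forall u, P u -> u <= M) -> exists2 u, P u & forall v, P v -> v <= u.
Proof.
move=> Pt PM; pose Q (k : nat) := `[< P (t + k%:Z) >].
have [||k /asboolP Pk k_max] := @ex_maxnP Q `|M - t|.
- by exists 0%N; apply/asboolP; rewrite addr0.
- by move=> k /asboolP/PM; lia.
exists (t + k%:Z) => // v Pv; have [vt|tv] := lerP v t; first lia.
have := k_max `|v - t|%N; suff -> : Q `|v - t|%N by lia.
by apply/asboolP; rewrite (_ : t + _ = v) //; lia.
Qed.

Lemma incr_onto_translation (u : int -> int) :
    {homo u : i j / i < j} -> (forall t, exists i, u i = t) ->
  forall i : int, u i = u 0 + i.
Proof.
move=> u_incr u_onto.
have u_le : {mono u : i j / i <= j} by apply: le_mono.
have uS i : u (i + 1) = u i + 1.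
  have [j uj] := u_onto (u i + 1).
  have ij : i < j by rewrite -(leW_mono u_le) uj; lia.
  have u_ij : u (i + 1) <= u j by rewrite u_le; lia.
  by have := u_incr i (i + 1); lia.
have drift : {homo (fun i => u i - i) : i j / i < j >-> i = j}.
  by apply: homo_ltz => [y x z -> //|i]; rewrite uS; ring.
by move=> i; case: (ltgtP i 0) => [/drift|/drift|->] /=; lia.
Qed.

Lemma ncl_uniq n X k l : ncl n X k -> ncl n X l -> k = l.
Proof.
move=> [s [us sX <-]] [t [ut tX <-]]; apply/perm_size/uniq_perm => // x.
by apply/idP/idP => [/sX/tX|/tX/sX].
Qed.

Lemma mem_chain_window n (X : cellset) (g : int -> cell) m a :
    (forall x, X x <-> exists i, x = g i) ->
    (forall i : int, (1 <= (g i).1 <= n%:Z) = (a <= i < a + m%:Z)) ->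
  forall x, x \in map g (iotaz a m) <-> X x /\ 1 <= x.1 <= n%:Z.
Proof.
move=> Xg window x; split=> [/mapP[i + ->]|[/Xg[i ->] i_row]].
  by rewrite mem_iotaz -window => i_row; split; first by apply/Xg; exists i.
by apply: map_f; rewrite mem_iotaz -window.
Qed.

Lemma periodic_chain_ncl n B X g m :
    periodic_chain n B g m 1 -> (forall x, X x <-> exists i, x = g i) -> ncl n X m.
Proof.
move=> g_chain Xg; have [a window] := periodic_chain_window g_chain.
rewrite mul1n in window; exists (map g (iotaz a m)).
split; [|exact: mem_chain_window|by rewrite size_map size_iotaz].
exact: periodic_chain_uniq g_chain a m.
Qed.

Section NumberedChannel.
Variables (n : nat) (B C : cellset) (dt : cell -> int).
Hypotheses (n_gt0 : (0 < n)%N) (B_perm : partial_perm n B).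
Hypotheses (C_channel : channel n B C) (C_num : numbering C dt).

Lemma channel_snwb c c' : C c -> C c' -> snwb c c' = (dt c < dt c').
Proof.
have [[CB _ C_total] _] := C_channel; have [dt_lt _] := C_num.
have [_ B_row B_col] := B_perm.
move=> Cc Cc'; apply/idP/idP => [/andP[cc1 cc2]|cc'].
  by apply: dt_lt => //; [move=> e; rewrite e ltxx in cc1 | split; apply: ltW].
have c_neq : c <> c' by move=> e; rewrite e ltxx in cc'.
have [[cc1 cc2]|c'c] := C_total c c' Cc Cc'; last first.
  by have := dt_lt _ _ Cc' Cc (nesym c_neq) c'c; rewrite ltNge ltW.
rewrite /snwb !lt_neqAle cc1 cc2 !andbT.
by apply/andP; split; apply/eqP => e; apply: c_neq; [apply: B_row | apply: B_col]; auto.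
Qed.

Lemma numbering_inj c c' : C c -> C c' -> dt c = dt c' -> c = c'.
Proof.
have [[_ _ C_total] _] := C_channel; have [dt_lt _] := C_num.
move=> Cc Cc' e; apply: contrapT => c_neq; have [cc'|c'c] := C_total c c' Cc Cc'.
  by have := dt_lt _ _ Cc Cc' c_neq cc'; rewrite e ltxx.
by have := dt_lt _ _ Cc' Cc (nesym c_neq) c'c; rewrite e ltxx.
Qed.

Lemma numbered_channel : exists (g : int -> cell) (m : nat),
  [/\ (0 < m)%N, periodic_chain n B g m 1, forall x, C x <-> exists i, x = g i &
      forall i, dt (g i) = i].
Proof.
have [[CB CT _] _] := C_channel; have [_ dt_onto] := C_num.
have [g g_num] := choice dt_onto.
have Cg i : C (g i) by case: (g_num i).
have dt_g i : dt (g i) = i by case: (g_num i).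
have g_dt c : C c -> g (dt c) = c by move=> Cc; apply: numbering_inj.
have g_incr i j : snwb (g i) (g j) = (i < j) by rewrite channel_snwb ?dt_g.
have CTg k i : C (translate n k (g i)) by apply/trinv_translate.
have dt_translate i : dt (translate n 1 (g i)) = dt (translate n 1 (g 0)) + i.
  apply: (@incr_onto_translation (fun i => dt (translate n 1 (g i)))) => [j l jl|t].
    by rewrite -channel_snwb ?snwb_translate ?g_incr.
  by exists (dt (translate n (- 1) (g t))); rewrite g_dt ?translateNK.
have m_gt0 : 0 < dt (translate n 1 (g 0)).
  by rewrite -{1}(dt_g 0) -channel_snwb // /snwb /translate /=; lia.
exists g, `|dt (translate n 1 (g 0))|%N; split=> //; first by rewrite absz_gt0 gt_eqF.
  split=> i; [exact: CB | by rewrite g_incr; lia|].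
  by rewrite -(g_dt _ (CTg 1 i)) (dt_translate i) gtz0_abs // addrC.
by move=> x; split=> [Cx|[i ->] //]; exists (dt x); rewrite g_dt.
Qed.

Lemma channel_max g m : periodic_chain n B g m 1 -> (forall x, C x <-> exists i, x = g i) ->
  forall Y l, chainset n B Y -> ncl n Y l -> (l <= m)%N.
Proof.
move=> g_chain Cg; have [_ [k [C_ncl k_max]]] := C_channel.
by rewrite -(ncl_uniq C_ncl (periodic_chain_ncl g_chain Cg)).
Qed.
End NumberedChannel.

Lemma snwb_translate_far n x y : (0 < n)%N -> exists k : int, snwb x (translate n k y).
Proof.
move=> n_gt0; pose k := `|x.1 - y.1|%N%:Z + `|x.2 - y.2|%N%:Z + 1; exists k.
have : k <= k * n%:Z by rewrite ler_peMr //; lia.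
by rewrite /snwb /translate /= /k; lia.
Qed.

Definition proper_numbering n (B : cellset) (d : cell -> int) (m : nat) : Prop :=
  [/\ (0 < m)%N,
      forall x k, B x -> d (translate n k x) = d x + k * m,
      forall x y, B x -> B y -> snwb x y -> d x < d y &
      forall x, B x -> exists y, [/\ B y, snwb y x & d y = d x - 1]].

Section Distance.
Variables (n : nat) (B C : cellset) (dt : cell -> int) (g : int -> cell) (m : nat).
Hypotheses (n_gt0 : (0 < n)%N) (m_gt0 : (0 < m)%N) (BT : trinv n B).
Hypothesis g_chain : periodic_chain n B g m 1.
Hypothesis Cg : forall x, C x <-> exists i, x = g i.
Hypothesis dt_g : forall i, dt (g i) = i.
Hypothesis m_max : forall Y l, chainset n B Y -> ncl n Y l -> (l <= m)%N.

Lemma translate_channel (k i : int) : translate n k (g i) = g (i + k * m).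
Proof. by rewrite (periodic_chain_translate g_chain) mulr1. Qed.

(* Closing the path up along the channel, [J] periods further northwest, yields a walk of
   winding number [J]; the claim is that its number of steps is at most [J m]. *)
Lemma dpath_channel_le c s :
  C c -> dpath B C c s -> dt (last c s) + (size s)%:Z <= dt c.
Proof.
have [gB _ _] := g_chain.
move=> /Cg[i ->] [sB s_path /Cg[j s_last]]; rewrite s_last !dt_g.
have [J iJj] : exists J : nat, i - J%:Z * m%:Z < j.
  by exists `|i - j|.+1; have := leq_pmulr `|i - j|.+1 m_gt0; lia.
have [a aE] : exists a, a = i - J%:Z * m%:Z + 1 by exists (i - J%:Z * m%:Z + 1).
have [r ar] : exists r : nat, a + r%:Z = j by exists `|j - a|%N; lia.
pose w := map g (iotaz (a + 1) r) ++ rev (belast (g i) s).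
have w_path : path snwb (g a) w.
  rewrite cat_path last_map last_iotaz ar -s_last rev_path s_path andbT.
  rewrite (homo_path (e := <%R)) //; first exact: periodic_chain_homo g_chain.
  by have := iotaz_sorted a r.+1; rewrite iotazS.
have w_last : last (g a) w = g i.
  rewrite last_cat last_map last_iotaz ar; case: (s) s_last => [<- //|y s' _] /=.
  by rewrite rev_cons last_rcons.
have wB : {in g a :: w, forall y, B y}.
  move=> y; rewrite inE mem_cat mem_rev => /predU1P[->|/orP[/mapP[t _ ->]|]] //.
  by move/mem_belast; rewrite inE => /predU1P[->|/sB].
have [|b b_chain] := closed_walk_periodic_chain (N := J) BT wB w_path.
  by rewrite w_last translate_channel (periodic_chain_mono g_chain) aE; lia.
have := winding_bound n_gt0 (ltn0Sn _) BT b_chain m_max.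
by rewrite size_cat size_map size_iotaz size_rev size_belast; lia.
Qed.

Lemma channel_translate k i : C (translate n k (g i)).
Proof. by apply/Cg; exists (i + k * m); apply: translate_channel. Qed.

Lemma dval_exists x : B x -> exists t, dval B C dt x t.
Proof.
move=> Bx; have [gB _ _] := g_chain.
have [c Cc xc] : exists2 c, C c & snwb x c.
  have [k xk] := snwb_translate_far x (g 0) n_gt0.
  by exists (translate n k (g 0)); first exact: channel_translate.
have [c' Cc' c'x] : exists2 c', C c' & snwb c' x.
  have [k gk] := snwb_translate_far (g 0) x n_gt0.
  exists (translate n (- k) (g 0)); first exact: channel_translate.
  by rewrite -(snwb_translate n k) translateNK.
pose P t := exists s, dpath B C x s /\ dt (last x s) + (size s)%:Z = t.
have Pc' : P (dt c' + 1).
  exists [:: c']; split=> //; split; rewrite /= ?c'x // => y.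
  by rewrite inE => /eqP ->; have [i ->] := (Cg c').1 Cc'.
have [t [s [[sB s_path s_last] <-]]|t Pt t_max] := @ex_maxz P (dt c - 1) _ Pc'.
  suff xs_dpath : dpath B C c (x :: s) by have /= := dpath_channel_le Cc xs_dpath; lia.
  by split=> //= [y|]; [rewrite inE => /predU1P[->|/sB] | rewrite xc].
by exists t; split=> // s s_dpath; apply: t_max; exists s.
Qed.

Variable d : cell -> int.
Hypothesis dP : forall x, B x -> dval B C dt x (d x).

Lemma distance_dpath_le x s :
  B x -> dpath B C x s -> dt (last x s) + (size s)%:Z <= d x.
Proof. by move=> /dP[_ d_max]; apply: d_max. Qed.

Lemma distance_translate_ge x (k : int) : B x -> d x + k * m <= d (translate n k x).
Proof.
move=> Bx; have [[s [[sB s_path /Cg[i s_last]] <-]] _] := dP Bx.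
have BTx : B (translate n k x) by apply/trinv_translate.
have := @distance_dpath_le _ (map (translate n k) s) BTx.
rewrite last_map size_map s_last translate_channel !dt_g addrAC; apply; split.
- by move=> _ /mapP[y /sB By ->]; apply/trinv_translate.
- by rewrite path_map; apply: sub_path s_path => y z; rewrite /= snwb_translate.
- by rewrite last_map s_last; apply: channel_translate.
Qed.

Lemma distance_lt x y : B x -> B y -> snwb x y -> d x < d y.
Proof.
move=> Bx By xy; have [[s [[sB s_path s_last] <-]] _] := dP Bx.
suff xs_dpath : dpath B C y (x :: s) by have /= := distance_dpath_le By xs_dpath; lia.
by split=> //= [z|]; [rewrite inE => /predU1P[->|/sB] | rewrite xy].
Qed.

Lemma distance_pred x : B x -> exists y, [/\ B y, snwb y x & d y = d x - 1].
Proof.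
move=> Bx; have [gB gS _] := g_chain.
suff [y [By yx yd]] : exists y, [/\ B y, snwb y x & d x - 1 <= d y].
  by exists y; split=> //; have := distance_lt By Bx yx; lia.
have [[[|y s] [[sB s_path s_last] <-]] _] := dP Bx.
  have /Cg[i /= xE] := s_last; exists (g (i - 1)).
  split; rewrite ?xE ?dt_g //; first by rewrite -{2}(subrK 1 i).
  suff nil_dpath : dpath B C (g (i - 1)) [::].
    by have /= := distance_dpath_le (gB _) nil_dpath; rewrite dt_g; lia.
  by split=> //=; apply/Cg; exists (i - 1).
have By : B y by apply: sB; rewrite mem_head.
have /andP[yx ys_path] := s_path; exists y; split=> //.
suff s_dpath : dpath B C y s by have /= := distance_dpath_le By s_dpath; lia.
by split=> // z zs; apply: sB; rewrite inE zs orbT.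
Qed.

Lemma distance_proper_numbering : proper_numbering n B d m.
Proof.
split=> //; [move=> x k Bx|exact: distance_lt|exact: distance_pred].
have BTx : B (translate n k x) by apply/trinv_translate.
apply/eqP; rewrite eq_le distance_translate_ge // andbT.
by have := distance_translate_ge (- k) BTx; rewrite translateK mulNr; lia.
Qed.
End Distance.

Lemma channel_proper_numbering n B C dt :
    (0 < n)%N -> partial_perm n B -> channel n B C -> numbering C dt ->
  exists d m, proper_numbering n B d m /\ forall x, B x -> dval B C dt x (d x).
Proof.
move=> n_gt0 B_perm C_channel C_num; have [BT _ _] := B_perm.
have [g [m [m_gt0 g_chain Cg dt_g]]] := numbered_channel n_gt0 B_perm C_channel C_num.
have m_max := channel_max C_channel g_chain Cg.
have /choice[d dP] : forall x, exists t, B x -> dval B C dt x t.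
  move=> x; have [Bx|nBx] := pselect (B x); last by exists 0.
  by have [t] := dval_exists n_gt0 m_gt0 BT g_chain Cg dt_g m_max Bx; exists t.
by exists d, m; split=> //; apply: distance_proper_numbering g_chain Cg dt_g _ dP.
Qed.

(** * One step of AMBC *)

Definition level_seq n (s : seq cell) (d : cell -> int) (m : nat) (t : int) : seq cell :=
  sort (fun x y => x.1 <= y.1)
    [seq translate n ((t - d y) %/ m)%Z y | y <- s & (m %| t - d y)%Z].

Section Levels.
Variables (n : nat) (B : cellset) (s : seq cell) (d : cell -> int) (m : nat).
Hypotheses (n_gt0 : (0 < n)%N) (Bs : ball_reps n B s).
Hypothesis d_num : proper_numbering n B d m.

Local Notation L := (level_seq n s d m).

Let BT : trinv n B.
Proof. by have [] := ball_reps_partial_perm n_gt0 Bs. Qed.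

Lemma mem_level_seq t x : x \in L t <-> B x /\ d x = t.
Proof.
have [m_gt0 d_translate _ _] := d_num.
rewrite mem_sort; split=> [/mapP[y]|[Bx <-]].
  rewrite mem_filter => /andP[m_dvd /(mem_ball_reps Bs) By ->].
  by split; [apply/trinv_translate | rewrite d_translate // divzK // addrC subrK].
have [/(_ x)[/(_ Bx)[y ys [k xE]] _] _ _] := Bs.
have By := mem_ball_reps Bs ys.
have dxy : d x - d y = k * m by rewrite xE d_translate // addrAC subrr add0r.
by apply/mapP; exists y; rewrite ?mem_filter dxy ?mulzK ?dvdz_mull //; lia.
Qed.

Lemma level_seq_sorted t : sorted <%R (map fst (L t)).
Proof.
have [_ row_uniq _] := Bs; rewrite lt_sorted_uniq_le; apply/andP; split; last first.
  by rewrite sorted_map; apply: sort_sorted => x y; apply: le_total.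
rewrite (perm_uniq (perm_map fst (permEl (perm_sort _ _)))).
apply: (@map_uniq _ _ (resid n)); rewrite -row_residuesE.
rewrite (row_residues_translate n (fun y => (t - d y) %/ m)%Z).
by apply: subseq_uniq row_uniq; apply/map_subseq/filter_subseq.
Qed.

Lemma level_seq_translate t (k : int) : L (t + k * m) = map (translate n k) (L t).
Proof.
have [_ d_translate _ _] := d_num.
apply: (irr_sorted_eq (leT := relpre fst <%R)) => [y x z|x|||x] /=.
- exact: lt_trans.
- exact: ltxx.
- by rewrite -sorted_map level_seq_sorted.
- rewrite sorted_map; have := level_seq_sorted t; rewrite sorted_map.
  by apply: sub_sorted => x y /=; rewrite ltrD2r.
apply/idP/mapP => [/mem_level_seq[Bx dx]|[y /mem_level_seq[By <-] ->]].
  exists (translate n (- k) x); last by rewrite translateNK.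
  apply/mem_level_seq; split; first exact/trinv_translate.
  by rewrite d_translate // dx mulNr addrK.
by apply/mem_level_seq; split; [apply/trinv_translate | rewrite d_translate].
Qed.

Lemma level_seq_neq0 t : (exists x, B x) -> L t != [::].
Proof.
move=> [x Bx]; have [m_gt0 d_translate _ d_pred] := d_num.
have [y By ty] : exists2 y, B y & t <= d y.
  exists (translate n `|t - d x|%N x); first exact/trinv_translate.
  by rewrite d_translate //; have := leq_pmulr `|t - d x| m_gt0; lia.
have descend k : exists2 z, B z & d z = d y - k%:Z.
  elim: k => [|k [z Bz dz]]; first by exists y; rewrite ?subr0.
  by have [z' [Bz' _ dz']] := d_pred z Bz; exists z' => //; lia.
have [z Bz dz] := descend `|d y - t|%N.
by have : z \in L t; [apply/mem_level_seq; split; [|lia] | case: (L t)].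
Qed.

Lemma level_seq_uniq (p : cell -> int) a :
    (forall k x, p (translate n k x) = p x + k * n) ->
    (forall x y, B x -> B y -> p x = p y -> x = y) ->
  uniq [seq resid n (p x) | x <- flatten (map L (iotaz a m))].
Proof.
move=> p_translate p_inj; have [_ d_translate _ _] := d_num.
rewrite map_flatten -map_comp.
apply: (@allpairs_uniq_dep _ _ _ (fun _ x => resid n (p x))) => [|t _|].
- exact: iotaz_uniq.
- by have := level_seq_sorted t => /lt_sorted_uniq/map_uniq.
move=> p1 p2 /allpairsPdep[t [x [t_window /mem_level_seq[Bx dx] ->]]].
move=> /allpairsPdep[u [y [u_window /mem_level_seq[By dy] ->]]].
rewrite !mem_iotaz /= in t_window u_window *; move=> /(eq_resid n_gt0); move: (_ - _) => k.
rewrite -p_translate => /p_inj xE.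
have {}xE : x = translate n k y by apply: xE => //; apply/trinv_translate.
have k0 : k = 0 by move: dx; rewrite xE d_translate // dy; nia.
by move: xE dx; rewrite k0 translate0 => ->; rewrite dy => ->.
Qed.

Lemma level_seq_ball_reps a : ball_reps n B (flatten (map L (iotaz a m))).
Proof.
have [_ B_row B_col] := ball_reps_partial_perm n_gt0 Bs.
have [m_gt0 d_translate _ _] := d_num.
split; [|exact: level_seq_uniq B_row|exact: level_seq_uniq B_col].
move=> x; split=> [Bx|[y /flatten_mapP[t _ /mem_level_seq[By _]] [k ->]]].
  have [c dx_window] := iotaz_cover a (d x) m_gt0.
  exists (translate n c x); last by exists (- c); rewrite translateK.
  apply/flatten_mapP; exists (d x + c * m) => //.
  by apply/mem_level_seq; split; [apply/trinv_translate | rewrite d_translate].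
exact/trinv_translate.
Qed.

(* Balls of a level are pairwise incomparable, so the southmost one is the westmost one. *)
Lemma back_cell_col_min t x : x \in L t -> (back_cell (L t)).2 <= x.2.
Proof.
have [_ _ d_lt _] := d_num.
move=> xt; have t_neq0 : L t != [::] by apply/eqP => t0; rewrite t0 in xt.
have [_ last_t] := mem_head_last t_neq0.
have /mem_level_seq[Bl dl] := last_t; have /mem_level_seq[Bx dx] := xt.
rewrite /back_cell leNgt; apply/negP => /= xl2.
have [xl1 x_max] := last_row_max (level_seq_sorted t) xt.
have x_neq : x != last (0, 0) (L t) by apply/eqP => xE; rewrite -xE ltxx in xl2.
have xl : snwb x (last (0, 0) (L t)) by rewrite /snwb xl2 lt_neqAle x_max x_neq xl1.
by have := d_lt _ _ Bx Bl xl; rewrite dx dl ltxx.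
Qed.

Lemma back_cell_periodic_chain (S : cellset) :
    (exists x, B x) -> (forall t, S (back_cell (L t))) ->
  periodic_chain n S (fun t => back_cell (L t)) m 1.
Proof.
move=> B_neq0 SL; have L_neq0 t := level_seq_neq0 t B_neq0.
have [_ _ _ d_pred] := d_num; split=> // t; last first.
  by rewrite -[m%:Z]mul1r level_seq_translate translate_back_cell.
have prev x : x \in L (t + 1) -> exists2 y, y \in L t & snwb y x.
  move=> /mem_level_seq[Bx dx]; have [y [By yx dy]] := d_pred x Bx.
  by exists y => //; apply/mem_level_seq; rewrite dy dx addrK.
have [/prev[y yt /andP[yh _]] /prev[z zt /andP[_ zl]]] := mem_head_last (L_neq0 (t + 1)).
rewrite /snwb (le_lt_trans (head_row_min (level_seq_sorted t) yt) yh).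
exact: le_lt_trans (back_cell_col_min zt) zl.
Qed.

Local Notation backs a := (map (fun t => back_cell (L t)) (iotaz a m)).
Local Notation outers a := (flatten (map outer_cells (map L (iotaz a m)))).

Lemma level_seq_split a : (exists x, B x) ->
  [/\ perm_eq (row_residues n s) (row_residues n (backs a ++ outers a)),
      perm_eq (col_residues n s) (col_residues n (backs a ++ outers a)) &
      twisted_parity n s = twisted_parity n (backs a ++ outers a) + (size (outers a))%:R].
Proof.
move=> B_neq0; set levels := map L (iotaz a m).
have [levels_row levels_col ->] := perm_ball_reps n_gt0 Bs (level_seq_ball_reps a).
have [_ row_uniq col_uniq] := level_seq_ball_reps a.
have zigzag_levels : perm_eq (flatten (map zigzag levels)) (backs a ++ outers a).
  rewrite map_comp; apply: perm_flatten_zigzag; apply/mapP => -[t _ /esym/eqP].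
  by rewrite (negPf (level_seq_neq0 t B_neq0)).
have zigzag_row :
    row_residues n (flatten (map zigzag levels)) = row_residues n (flatten levels).
  by rewrite !row_residuesE flatten_zigzag_rows.
have zigzag_col : perm_eq (col_residues n (flatten levels))
    (col_residues n (flatten (map zigzag levels))).
  by rewrite !col_residuesE perm_map // perm_sym perm_flatten_zigzag_cols.
split.
- by rewrite (perm_trans levels_row) // -zigzag_row perm_map.
- by rewrite (perm_trans levels_col) // (perm_trans zigzag_col) // perm_map.
rewrite twisted_parity_zigzag //; congr (_ + _).
by apply: perm_twisted_parity; rewrite ?zigzag_row // -(perm_uniq zigzag_col).
Qed.

Lemma outer_cells_ball_reps (B' : cellset) a :
    (exists x, B x) -> (forall x, B' x <-> exists t, x \in outer_cells (L t)) ->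
  ball_reps n B' (outers a).
Proof.
move=> B_neq0 B'L; have [m_gt0 _ _ _] := d_num; have [_ row_uniq col_uniq] := Bs.
have [row_perm col_perm _] := level_seq_split a B_neq0; split.
- move=> x; split=> [/B'L[t xt]|[y /flatten_mapP[l /mapP[t _ ->] yt] [k ->]]].
    have [c t_window] := iotaz_cover a t m_gt0.
    exists (translate n c x); last by exists (- c); rewrite translateK.
    apply/flatten_mapP; exists (L (t + c * m)); first exact: map_f.
    by rewrite level_seq_translate translate_outer_cells map_f.
  by apply/B'L; exists (t + k * m); rewrite level_seq_translate translate_outer_cells map_f.
- by move: row_uniq; rewrite (perm_uniq row_perm) row_residues_cat cat_uniq => /and3P[].
- by move: col_uniq; rewrite (perm_uniq col_perm) col_residues_cat cat_uniq => /and3P[].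
Qed.
End Levels.

Lemma dval_uniq B C dt x t u : dval B C dt x t -> dval B C dt x u -> t = u.
Proof.
move=> [[s [s_dpath <-]] t_max] [[s' [s'_dpath <-]] u_max].
by apply/eqP; rewrite eq_le u_max // t_max.
Qed.

Lemma ambc_step_levels n B B' S s : (0 < n)%N -> ball_reps n B s -> ambc_step n B B' S ->
  exists d m, let L := level_seq n s d m in
  [/\ exists x, B x, proper_numbering n B d m,
      forall x, B' x <-> exists t, x \in outer_cells (L t) &
      forall x, S x <-> exists t, x = back_cell (L t)].
Proof.
move=> n_gt0 Bs [C [dt [C_channel _ C_num B'P SP]]].
have B_perm := ball_reps_partial_perm n_gt0 Bs.
have [d [m [d_num dP]]] := channel_proper_numbering n_gt0 B_perm C_channel C_num.
have B_neq0 : exists x, B x.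
  have [[CB _ _] _] := C_channel; have [_ /(_ 0)[c [Cc _]]] := C_num.
  by exists c; apply: CB.
exists d, m; set L := level_seq n s d m => /=.
have levelE t x : level B C dt t x <-> x \in L t.
  rewrite (mem_level_seq n_gt0 Bs d_num).
  split=> -[Bx]; last by move=> <-; split; last exact: dP.
  by split=> //; apply: dval_uniq (dP x Bx) _.
have L_sorted t := level_seq_sorted d m Bs t.
have L_neq0 t := level_seq_neq0 n_gt0 Bs d_num t B_neq0.
split=> // x; rewrite ?B'P ?SP; split=> -[t xt]; exists t; move: xt.
- by move/(outer_corner_sorted (levelE t) (L_sorted t)).
- by move/(outer_corner_sorted (levelE t) (L_sorted t)).
- by move/(back_corner_sorted (levelE t) (L_sorted t) (L_neq0 t)).
- by move/(back_corner_sorted (levelE t) (L_sorted t) (L_neq0 t)).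
Qed.

Lemma pairwise_iotaz (r : rel int) a k :
    (forall i j : int, i < j -> j < i + k%:Z -> r i j) -> pairwise r (iotaz a k).
Proof.
move=> r_lt; apply: (sub_in_pairwise (P := mem (iotaz a k)) (r := <%R)) => [i j||].
- by rewrite !mem_iotaz => i_in j_in /= ij; apply: r_lt; lia.
- exact/allP.
by have := iotaz_sorted a k; rewrite lt_sorted_pairwise.
Qed.

Lemma twisted_parity_chain n B g m a : (0 < n)%N -> periodic_chain n B g m 1 ->
  twisted_parity n (map g (iotaz a m)) = m%:R * (altitude n (map g (iotaz a m)))%:~R.
Proof.
move=> n_gt0 g_chain; rewrite twisted_parity_floor_sum // size_map size_iotaz.
have within_period i j : i < j -> j < i + m%:Z ->
    [/\ (g i).1 < (g j).1, (g j).1 < (g i).1 + n%:Z,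
        (g i).2 < (g j).2 & (g j).2 < (g i).2 + n%:Z].
  move=> ij jim; have /andP[-> ->] := periodic_chain_homo g_chain ij.
  have [_ _ gm] := g_chain; have := periodic_chain_homo g_chain jim.
  by rewrite gm /snwb /translate /= !mul1r => /andP[-> ->].
by rewrite !floor_sum0 ?add0r //; rewrite 2!pairwise_map;
  apply: pairwise_iotaz => i j ij jim /=; have [] := within_period i j ij jim; lia.
Qed.

Section ChainRecords.
Variables (n : nat) (S : cellset) (g : int -> cell) (m : nat) (a : int).
Hypotheses (m_gt0 : (0 < m)%N) (g_chain : periodic_chain n S g m 1).
Hypothesis Sg : forall x, S x <-> exists t, x = g t.

Local Notation chain := (map g (iotaz a m)).

Lemma rec_rows_chain p q :
    rec_rows n S p q -> uniq (row_residues n chain) -> uniq (col_residues n chain) ->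
  perm_eq (row_residues n chain) q /\ perm_eq (col_residues n chain) p.
Proof.
move=> [p_uniq q_uniq Sp Sq] row_uniq col_uniq.
have chain_cover x : S x -> exists k, translate n k x \in chain.
  move=> /Sg[t ->]; have [k tk] := iotaz_cover a t m_gt0; exists k.
  by apply/mapP; exists (t + k * m); rewrite ?(periodic_chain_translate g_chain) ?mulr1.
have chainS x : x \in chain -> S x by move=> /mapP[t _ ->]; apply/Sg; exists t.
have rec_coord (c : cell -> int) (u : tabrow) :
    (forall k x, c (translate n k x) = c x + k * n) -> uniq u ->
    (forall i, i \in u <-> exists x, S x /\ resid n (c x) = i) ->
    uniq [seq resid n (c x) | x <- chain] -> perm_eq [seq resid n (c x) | x <- chain] u.
  move=> c_translate u_uniq Su c_uniq; apply: uniq_perm => // i.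
  apply/mapP/idP => [[x /chainS Sx ->]|/Su[x [/chain_cover[k xk] <-]]].
    by apply/Su; exists x.
  by exists (translate n k x); rewrite ?c_translate ?resid_shift.
by split; apply: rec_coord.
Qed.

Lemma rec_rho_chain r l :
    (forall i : int, (1 <= (g i).1 <= n%:Z) = (a <= i < a + m%:Z)) -> rec_rho n S r l ->
  l = m /\ r = altitude n chain.
Proof.
move=> window [s [s_uniq sS <- ->]].
have s_chain : perm_eq s chain.
  apply: uniq_perm => // [|x]; first exact: periodic_chain_uniq g_chain a m.
  have memE := mem_chain_window Sg window x.
  by apply/idP/idP => [/sS/memE|/memE/sS].
by rewrite (perm_size s_chain) size_map size_iotaz /altitude (perm_big _ s_chain).
Qed.
End ChainRecords.

Lemma ambc_step_parity n B B' S s p q r l :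
    (0 < n)%N -> ball_reps n B s ->
    ambc_step n B B' S -> rec_rows n S p q -> rec_rho n S r l ->
  exists s', [/\ ball_reps n B' s',
      perm_eq (row_residues n s) (q ++ row_residues n s'),
      perm_eq (col_residues n s) (p ++ col_residues n s'),
      size s = (l + size s')%N &
      twisted_parity n s = twisted_parity n s' + l%:R * r%:~R + (size s')%:R +
        (cross_inversions q (row_residues n s'))%:R +
        (cross_inversions p (col_residues n s'))%:R].
Proof.
move=> n_gt0 Bs step pqP rlP.
have [d [m [B_neq0 d_num B'L SL]]] := ambc_step_levels n_gt0 Bs step.
have [m_gt0 _ _ _] := d_num; have [_ row_uniq col_uniq] := Bs.
have S_back t : S (back_cell (level_seq n s d m t)) by apply/SL; exists t.
have chain := back_cell_periodic_chain n_gt0 Bs d_num B_neq0 S_back.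
have [a window] := periodic_chain_window chain; rewrite mul1n in window.
have [row_perm col_perm parity] := level_seq_split n_gt0 Bs d_num a B_neq0.
have Bs' := outer_cells_ball_reps n_gt0 Bs d_num a B_neq0 B'L.
have [-> ->] := rec_rho_chain chain SL window rlP.
rewrite twisted_parity_cat (twisted_parity_chain a n_gt0 chain) in parity.
set s' := flatten _ in Bs' row_perm col_perm parity.
move: row_uniq col_uniq; rewrite (perm_uniq row_perm) (perm_uniq col_perm).
rewrite row_residues_cat col_residues_cat !cat_uniq.
move=> /and3P[row_uniq _ _] /and3P[col_uniq _ _].
have [q_perm p_perm] := rec_rows_chain m_gt0 chain SL pqP row_uniq col_uniq.
exists s'; split=> //.
- by rewrite (perm_trans row_perm) // row_residues_cat perm_cat2r.
- by rewrite (perm_trans col_perm) // col_residues_cat perm_cat2r.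
- by have := perm_size row_perm; rewrite !size_map size_cat size_map size_iotaz.
rewrite parity (perm_cross_inversions q_perm (perm_refl _)).
by rewrite (perm_cross_inversions p_perm (perm_refl _)); ring.
Qed.

(** * Iterating AMBC *)

Definition inv_rows (T : tabloid) : nat := pair_sum cross_inversions T.

Lemma inv_rows_cons p T :
  inv_rows (p :: T) = (cross_inversions p (flatten T) + inv_rows T)%N.
Proof. by rewrite cross_inversions_flatten. Qed.

Local Arguments rowidx : simpl never.

Lemma sum_rowidx_inversions (T : tabloid) : uniq (flatten T) ->
  (\sum_(i <- flatten T) \sum_(j <- flatten T) ((i < j) && (rowidx T j < rowidx T i)) =
   inv_rows T)%N.
Proof.
elim: T => [|p T IH] /=; first by rewrite big_nil.
rewrite cat_uniq inv_rows_cons => /and3P[_ /hasPn T_notin_p /IH <-] {IH}.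
have rowidx_p i : i \in p -> rowidx (p :: T) i = 0%N by rewrite /rowidx /= => ->.
have rowidx_T i : i \in flatten T -> rowidx (p :: T) i = (rowidx T i).+1.
  by move=> /T_notin_p /= /negbTE iNp; rewrite /rowidx /= iNp.
rewrite big_cat big1_seq /= => [|i /rowidx_p ip]; last first.
  by rewrite big1_seq // => j _; rewrite ip ltn0 andbF.
rewrite add0n [cross_inversions _ _]exchange_big -big_split /=.
apply: eq_big_seq => i iT; rewrite big_cat; congr addn.
  by apply: eq_big_seq => j jp; rewrite rowidx_p // rowidx_T // andbT.
by apply: eq_big_seq => j jT; rewrite !rowidx_T // ltnS.
Qed.

Lemma inv_tabE n (T : tabloid) : perm_eq (flatten T) (iota 1 n) -> inv_tab n T = inv_rows T.
Proof.
move=> T_perm; rewrite -sum_rowidx_inversions ?(perm_uniq T_perm) ?iota_uniq //.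
rewrite (perm_big _ T_perm) /inv_tab {1}/index_iota subn1 /=; apply: eq_bigr => i _.
rewrite (perm_big _ T_perm) (big_nat_widenl _ 1) // big_mkcond /index_iota subn1 /=.
by apply: eq_bigr => j _; case: ltnP.
Qed.

Lemma inv_part_cons l lam : (inv_part (l :: lam) + inv_part lam = sumn lam)%N.
Proof.
rewrite /inv_part big_mkcond big_ord_recl /= add0n -big_mkcond /=.
rewrite sumnE (big_nth 0%N) big_mkord [RHS](bigID (fun i : 'I__ => odd i)) /= addnC.
by congr addn.
Qed.

Lemma inv_rho_cons l lam r rho :
  inv_rho (l :: lam) (r :: rho) = (if odd l then r else 0) + inv_rho lam rho.
Proof. by rewrite /inv_rho big_mkcond big_ord_recl -big_mkcond. Qed.

Lemma AMBC_twisted_parity n B P Q rho lam s :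
    (0 < n)%N -> AMBC n B P Q rho lam -> ball_reps n B s ->
  [/\ perm_eq (row_residues n s) (flatten Q), perm_eq (col_residues n s) (flatten P),
      sumn lam = size s &
      twisted_parity n s =
      (inv_rows P + inv_rows Q + inv_part lam)%:R + (inv_rho lam rho)%:~R].
Proof.
move=> n_gt0 ambc; elim: ambc s => {B P Q rho lam} [B B0 s Bs|].
  have -> : s = [::].
    by case: s Bs => // x s /mem_ball_reps-/(_ x (mem_head _ _))/B0.
  by rewrite /twisted_parity /altitude big_nil /inv_part /inv_rho !big_ord0.
move=> B B' S p q r l P Q rho lam _ step pqP rlP _ IH s Bs.
have [s' [Bs' row_perm col_perm s_size ->]] := ambc_step_parity n_gt0 Bs step pqP rlP.
have [row_perm' col_perm' lam_size ->] := IH s' Bs'.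
split.
- by rewrite (perm_trans row_perm) //= perm_cat2l.
- by rewrite (perm_trans col_perm) //= perm_cat2l.
- by rewrite s_size -lam_size.
rewrite !inv_rows_cons (perm_cross_inversions (perm_refl _) row_perm').
rewrite (perm_cross_inversions (perm_refl _) col_perm') -lam_size -(inv_part_cons l).
rewrite inv_rho_cons intrD.
have -> : (if odd l then r else 0)%:~R = l%:R * r%:~R :> bool.
  by rewrite natr_odd; case: (odd l); rewrite ?mul1r ?mul0r.
rewrite !natrD; ring: natr2_bool.
Qed.

(** * The length of an affine permutation *)

Section AffinePermutation.
Variables (n : nat) (f : int -> int).
Hypotheses (n_gt0 : (0 < n)%N) (f_inj : injective f).
Hypothesis f_shift : forall i, f (i + n%:Z) = f i + n%:Z.

Definition graph_ball (i : nat) : cell := (i%:Z, f i%:Z).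

Definition graph_reps : seq cell := map graph_ball (iota 1 n).

Lemma affine_shift (i k : int) : f (i + k * n) = f i + k * n.
Proof.
elim/int_rect: k => [|k IH|k IH]; first by rewrite mul0r !addr0.
  by rewrite intS mulrDl mul1r [n%:Z + _]addrC !addrA f_shift IH.
apply: (addIr n%:Z); rewrite -f_shift -!addrA.
have -> : - k.+1%:Z * n + n = - k%:Z * n by rewrite intS; ring.
exact: IH.
Qed.

Lemma row_residues_graph : row_residues n graph_reps = iota 1 n.
Proof.
rewrite /row_residues -map_comp -[RHS]map_id; apply/eq_in_map => i.
by rewrite mem_iota => i_range; apply: resid_small; lia.
Qed.

Lemma resid_graph_inj : {in iota 1 n &, injective (fun i => resid n (f i%:Z))}.
Proof.
move=> i j; rewrite !mem_iota => i_range j_range /(eq_resid n_gt0).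
rewrite -affine_shift => /f_inj /(congr1 (resid n)).
by rewrite resid_shift !resid_small //; lia.
Qed.

Lemma graph_ball_reps : ball_reps n (graph f) graph_reps.
Proof.
split.
- move=> x; rewrite /graph.
  split=> [fx|[_ /mapP[i _ ->] [k ->]]]; last by rewrite /= affine_shift.
  have x_range := resid_range n_gt0 x.1; have x_eq := ceilz_resid_eq n_gt0 x.1.
  exists (graph_ball (resid n x.1)); first by apply: map_f; rewrite mem_iota; lia.
  exists (ceilz n x.1 - 1); rewrite /translate /= -affine_shift.
  by rewrite [_%:Z + _]addrC -x_eq fx -surjective_pairing.
- by rewrite row_residues_graph iota_uniq.
- by rewrite /col_residues -map_comp map_inj_in_uniq ?iota_uniq //; apply: resid_graph_inj.
Qed.

Lemma perm_col_residues_graph : perm_eq (col_residues n graph_reps) (iota 1 n).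
Proof.
have [_ _ col_uniq] := graph_ball_reps.
have col_sub : {subset col_residues n graph_reps <= iota 1 n}.
  by move=> _ /mapP[x _ ->]; rewrite mem_iota add1n ltnS resid_range.
apply: uniq_perm (iota_uniq 1 n) _ => //.
by have [] := uniq_min_size col_uniq col_sub; rewrite ?size_map ?size_iota.
Qed.

Definition graph_floor (i j : nat) : int := ((f j%:Z - f i%:Z) %/ n)%Z.

Lemma sne_graph (i j : nat) (k : int) : (0 < i <= n)%N -> (0 < j <= n)%N ->
  sne (graph_ball i) (translate n k (graph_ball j)) <->
  (j <= i)%N%:Z <= k < - graph_floor i j.
Proof.
move=> i_range j_range; rewrite /sne /= ltrNr /graph_floor ltz_divLR // mulNr.
have -> : (f j%:Z + k * n < f i%:Z) = (f j%:Z - f i%:Z < - (k * n)) by lia.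
have -> : (i%:Z < j%:Z + k * n) = ((j <= i)%N%:Z <= k) by case: leqP => ij; nia.
by split=> [[-> ->]|/andP].
Qed.

Definition inversion_count (i j : nat) : nat :=
  if graph_floor i j < 0 then (`|graph_floor i j| - (j <= i))%N else 0%N.

Definition inversion_shifts (i j : nat) : seq int :=
  iotaz (j <= i)%N%:Z (inversion_count i j).

Lemma mem_inversion_shifts i j k : (0 < i <= n)%N -> (0 < j <= n)%N ->
  k \in inversion_shifts i j <-> sne (graph_ball i) (translate n k (graph_ball j)).
Proof.
move=> i_range j_range; rewrite sne_graph // mem_iotaz /inversion_count.
by case: (ltrP (graph_floor i j) 0); case: (leqP j i) => *; split; lia.
Qed.

Definition graph_inversions : seq (cell * cell) :=
  [seq (graph_ball ij.1, translate n k (graph_ball ij.2))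
     | ij <- [seq (i, j) | i <- iota 1 n, j <- iota 1 n], k <- inversion_shifts ij.1 ij.2].

Lemma mem_graph_inversions a b :
  (a, b) \in graph_inversions <->
  [/\ graph f a, graph f b, sne a b & 1 <= a.1 <= n%:Z].
Proof.
split=> [/allpairsPdep[_ [k [/allpairsP[[i j] [/= i_in j_in ->]] k_in [-> ->]]]]|].
  rewrite !mem_iota in i_in j_in; rewrite /graph /= affine_shift.
  by split=> //; apply/mem_inversion_shifts.
case: a b => [a1 a2] [b1 b2]; rewrite /graph /= => -[<- <- ab a_row].
have b_eq := ceilz_resid_eq n_gt0 b1; have b_range := resid_range n_gt0 b1.
have aE : a1 = `|a1|%N%:Z by lia.
have bE : (b1, f b1) = translate n (ceilz n b1 - 1) (graph_ball (resid n b1)).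
  by rewrite /translate /= -affine_shift [_%:Z + _]addrC -b_eq.
apply/allpairsPdep; exists (`|a1|%N, resid n b1), (ceilz n b1 - 1); split=> /=.
- by apply/allpairsP; exists (`|a1|%N, resid n b1); rewrite !mem_iota; split=> //=; lia.
- by apply/mem_inversion_shifts => //; [lia | rewrite -bE /graph_ball -aE].
by rewrite -bE /graph_ball -aE.
Qed.

Lemma graph_inversions_uniq : uniq graph_inversions.
Proof.
apply: allpairs_uniq_dep => [|ij _|].
- by apply: allpairs_uniq; rewrite ?iota_uniq // => -[i j] [i' j'].
- exact: iotaz_uniq.
move=> p1 p2 /allpairsPdep[_ [k [/allpairsP[[i j] [_ /= j_in ->]] _ ->]]].
move=> /allpairsPdep[_ [k' [/allpairsP[[i' j'] [_ /= j'_in ->]] _ ->]]] /=.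
rewrite !mem_iota in j_in j'_in; move=> [-> _ rowE _].
have jE : j = j'.
  by have := congr1 (resid n) rowE; rewrite !resid_shift !resid_small.
have kE : k = k' by move: rowE; rewrite jE => /addrI/mulIf->; lia.
by rewrite jE kE.
Qed.

Lemma affine_length_sum len : affine_length n f len ->
  len = (\sum_(i <- iota 1 n) \sum_(j <- iota 1 n) inversion_count i j)%N.
Proof.
move=> [s [s_uniq sP <-]].
have -> : size s = size graph_inversions.
  apply/perm_size/uniq_perm; rewrite ?graph_inversions_uniq // => -[a b].
  by apply/idP/idP => [/sP/mem_graph_inversions|/mem_graph_inversions ab]; last exact/sP.
rewrite size_allpairs_dep sumnE big_map big_allpairs.
by apply: eq_bigr => i _; apply: eq_bigr => j _; rewrite size_iotaz.
Qed.

Lemma inversion_countD (i j : nat) : (0 < i)%N -> (i < j)%N -> (j <= n)%N ->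
  (inversion_count i j + inversion_count j i)%N = `|graph_floor i j|%N.
Proof.
move=> i_gt0 ij jn.
have resid_neq : resid n (f i%:Z) <> resid n (f j%:Z).
  by move/resid_graph_inj; rewrite !mem_iota; lia.
have : graph_floor i j + graph_floor j i = - 1.
  by rewrite /graph_floor !divz_sub_ceilz //; move: resid_neq; case: ltngtP => //; lia.
rewrite /inversion_count (leqNgt j i) ij (ltnW ij).
by case: (ltrP (graph_floor i j) 0); case: (ltrP (graph_floor j i) 0); lia.
Qed.

Lemma Shi_length_formula len : affine_length n f len ->
  len = pair_sum (fun i j => `|graph_floor i j|%N) (iota 1 n).
Proof.
move=> /affine_length_sum->; rewrite sum_sum_pair_sum big1 ?add0r => [|i _]; last first.
  by rewrite /inversion_count /graph_floor subrr div0z.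
apply: (eq_pair_sum (r := ltn)) => [|i j].
  by rewrite -(sorted_pairwise ltn_trans) iota_ltn_sorted.
by rewrite !mem_iota => i_range j_range ij; apply: inversion_countD; lia.
Qed.

Lemma floor_sum_rows_graph : floor_sum n (map fst graph_reps) = 0.
Proof.
apply: floor_sum0; rewrite !pairwise_map.
apply: (sub_in_pairwise (P := mem (iota 1 n)) (r := ltn)) => [i j||].
- by rewrite !mem_iota /=; lia.
- exact/allP.
- by rewrite -(sorted_pairwise ltn_trans) iota_ltn_sorted.
Qed.

Lemma sum_displacement_graph :
  \sum_(1 <= i < n.+1) (f i%:Z - i%:Z) = n%:Z * altitude n graph_reps.
Proof.
have resid_sum : \sum_(i <- iota 1 n) (resid n (f i%:Z))%:Z = \sum_(i <- iota 1 n) i%:Z.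
  by rewrite -[RHS](perm_big _ perm_col_residues_graph) /= !big_map.
rewrite /altitude big_map mulr_sumr /index_iota subn1 sumrB -resid_sum -sumrB.
apply: eq_big_seq => i; rewrite mem_iota => i_range /=.
rewrite [ceilz n i%:Z]ceilz_small //.
by rewrite {1}(ceilz_resid_eq n_gt0 (f i%:Z)) addrK mulrC.
Qed.

Lemma twisted_parity_graph len : affine_length n f len ->
  twisted_parity n graph_reps = len%:R + (\sum_(1 <= i < n.+1) (f i%:Z - i%:Z))%:~R.
Proof.
move=> /Shi_length_formula->; rewrite twisted_parity_floor_sum // floor_sum_rows_graph.
rewrite sum_displacement_graph rmorphM /= -pmulrn size_map size_iota add0r; congr (_ + _).
rewrite /floor_sum !pair_sum_map !raddf_pair_sum; congr pair_sum.
by apply/funext => i; apply/funext => j; rewrite /= natr_absz.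
Qed.
End AffinePermutation.

Theorem theorem4p4 (n : nat) (f : int -> int) (P Q : tabloid) (rho : seq int)
    (lam : seq nat) (len : nat) :
  (0 < n)%N ->
  bijective f ->
  (forall i, f (i + n%:Z) = f i + n%:Z) ->
  AMBC n (graph f) P Q rho lam ->
  affine_length n f len ->
  (-1) ^+ len * m1pow (\sum_(1 <= i < n.+1) (f i%:Z - i%:Z))
  = m1pow ((inv_tab n P + inv_tab n Q + inv_part lam)%:Z + inv_rho lam rho).
Proof.
move=> n_gt0 /bij_inj f_inj f_shift ambc f_len.
have reps := graph_ball_reps n_gt0 f_inj f_shift.
have [Q_rows P_cols _ parity] := AMBC_twisted_parity n_gt0 ambc reps.
have Q_iota : perm_eq (flatten Q) (iota 1 n).
  by rewrite -(row_residues_graph f n_gt0) perm_sym.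
have P_iota : perm_eq (flatten P) (iota 1 n).
  by rewrite -(permPl P_cols) perm_col_residues_graph.
rewrite (inv_tabE P_iota) (inv_tabE Q_iota) !m1pow_intr -signr_odd -natr_odd -signr_addb.
rewrite -[_ (+) _](twisted_parity_graph n_gt0 f_inj f_shift f_len) parity.
by rewrite intrD -pmulrn.
Qed.
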